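(* Let $R$ be a commutative ring and $P$ a polytope (not necessarily balanced). Then the center $Z(\mathbb{E}(R,P))$ of the stable group of elementary automorphisms $\mathbb{E}(R,P)$ is trivial.
   Context: **Polytopes and column vectors.** All polytopes are convex lattice polytopes $P\subset\mathbb{R}^n$ (vertices in $\mathbb{Z}^n$), $L_P=P\cap\mathbb{Z}^n$. Standing assumption: $\dim P=n$ and $\mathbb{Z}^n$ is the smallest affine sublattice of $\mathbb{R}^n$ containing $L_P$. For a facet $F$ of $P$, $\langle F,-\rangle:\mathbb{Z}^n\to\mathbb{Z}$ is the unique surjective group homomorphism that vanishes on differences of points of $\mathbb{Z}^n\cap\mathrm{Aff}(F)$ and whose minimum $b_F$ on $L_P$ is attained at the lattice points of $F$; put $\mathrm{ht}_F(x)=\langle F,x\rangle-b_F$. A vector $v\in\mathbb{Z}^n$, $v\ne0$, is a column vector of $P$ if there is a facet $F$ with $x+v\in P$ for all $x\in L_P\setminus F$; this $F$ is unique, called the base facet of $v$ and denoted $P_v$. $\mathrm{Col}(P)$ is the set of column vectors; it is assumed that $P$ has at least one column vector. ($P$ is called balanced if $\langle P_u,v\rangle\le1$ for all $u,v\in\mathrm{Col}(P)$; this is not assumed here.) **Elementary automorphisms.** $S_P\subset\mathbb{Z}^{n+1}$ is the additive semigroup generated by $\{(x,1):x\in L_P\}$, $R[P]=R[S_P]$. Identify $x\in L_P$ with $(x,1)$ and $v\in\mathrm{Col}(P)$ with $(v,0)$. For $v\in \mathrm{Col}(P)$, $\lambda\in R$, $e_v^\lambda$ is the graded $R$-algebra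 automorphism of $R[P]$ with $x\mapsto(1+\lambda v)^{\mathrm{ht}_{P_v}(x)}x$ for $x\in L_P$ (the semigroup operation written multiplicatively). **Doubling.** Let $F$ be a facet of $P$, translated so that $0\in F$. Let $\rho:\mathbb{R}^n\to\mathbb{R}^{n+1}=\mathbb{R}^n\oplus\mathbb{R}$ be the linear isometric embedding that is the identity on the linear span of $F$ and sends the unit normal of $F$ pointing into $P$ to the last standard basis vector. Put $P^{\square_F}=\mathrm{conv}(P\cup\rho(P))\subset\mathbb{R}^{n+1}$, a lattice polytope with respect to the lattice $\mathbb{Z}^n+\rho(\mathbb{Z}^n)$, which is renamed $\mathbb{Z}^{n+1}$. One has $\mathrm{Col}(P)\subset\mathrm{Col}(P^{\square_F})$. For $v\in\mathrm{Col}(P)$ write $P^{\square_v}=P^{\square_{P_v}}$. **Doubling spectra and stable group.** A doubling spectrum is an infinite chain $\mathfrak{P}=(P=P_0\subset P_1\subset\cdots)$ such that (i) for every $i\ge0$ there is $v\in\mathrm{Col}(P_i)$ with $P_{i+1}=P_i^{\square_v}$; (ii) for every $i$ and $v\in\mathrm{Col}(P_i)$ there is $j\ge i$ with $P_{j+1}=P_j^{\square_v}$. Put $R[\mathfrak{P}]=\varinjlim R[P_i]$, $\mathrm{Col}(\mathfrak{P})=\bigcup_i\mathrm{Col}(P_i)$. For $v\in\mathrm{Col}(\mathfrak P)$ the $e_v^\lambda$ on $R[P_j]$, $j\gg0$, are compatible and define an automorphism $e_v^\lambda$ of $R[\mathfrak{P}]$. $\mathbb{E}(R,P)$ is the subgroup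 of $\mathrm{Aut}(R[\mathfrak{P}])$ generated by all $e_v^\lambda$, $v\in\mathrm{Col}(\mathfrak P)$, $\lambda\in R$; it is independent of $\mathfrak{P}$ up to natural isomorphism. *)

(* Defs.v *)
From HB Require Import structures.
From mathcomp Require Import all_boot all_order all_algebra finmap.
From mathcomp Require Import mathcomp_extra boolp classical_sets reals.
From mathcomp.multinomials Require Import monalg.

Set Implicit Arguments.
Unset Strict Implicit.
Unset Printing Implicit Defensive.

Import Order.TTheory GRing.Theory Num.Theory.

Local Open Scope ring_scope.
Local Open Scope classical_set_scope.

Section Polytopes.
Context {K : realType}.

Definition toR n (x : 'rV[int]_n) : 'rV[K]_n := map_mx intr x.

Definition affine_hull n (A : set 'rV[K]_n) : set 'rV[K]_n :=
  [set x | exists m (c : 'rV[K]_m) (X : 'M[K]_(m, n)),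
     [/\ \sum_i c 0 i = 1, forall i, A (row i X) & x = c *m X]].

Definition convex_hull n (A : set 'rV[K]_n) : set 'rV[K]_n :=
  [set x | exists m (c : 'rV[K]_m) (X : 'M[K]_(m, n)),
     [/\ forall i, 0 <= c 0 i, \sum_i c 0 i = 1, forall i, A (row i X)
       & x = c *m X]].

(* The affine hull of A is x0 + V with V the row space of B, dim V = d. *)
Definition affine_dim n (A : set 'rV[K]_n) (d : nat) : Prop :=
  exists (x0 : 'rV[K]_n) (B : 'M[K]_(d, n)),
    row_free B /\ affine_hull A = [set x | (x - x0 <= B)%MS].

Definition lattice_points n (P : set 'rV[K]_n) : set 'rV[int]_n :=
  [set x | P (toR x)].

(* The last clause: every affine sublattice x0 + H containing L_P is Z^n. *)
Definition lattice_polytope n (P : set 'rV[K]_n) : Prop :=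
  [/\ exists s : seq 'rV[int]_n, P = convex_hull [set toR x | x in [set` s]],
      affine_dim P n
    & forall (x0 : 'rV[int]_n) (H : {pred 'rV[int]_n}), zmod_closed H ->
        (forall x, lattice_points P x -> x - x0 \in H) ->
        forall x, x - x0 \in H].

Definition facet n (P F : set 'rV[K]_n) : Prop :=
  exists (a : 'cV[K]_n) (c : K) (d : nat),
    [/\ forall x, P x -> c <= (x *m a) 0 0,
        F = [set x | P x /\ (x *m a) 0 0 = c],
        affine_dim F d & d.+1 = n].

Definition facet_form n (P F : set 'rV[K]_n)
    (f : {additive 'rV[int]_n -> int}) (b : int) : Prop :=
  [/\ forall k, exists x, f x = k,
      forall x y, affine_hull F (toR x) -> affine_hull F (toR y) ->
        f (x - y) = 0,
      forall x, lattice_points P x -> b <= f x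
    & forall x, lattice_points P x -> F (toR x) -> f x = b].

(* For a facet F of P the pair (f, b) exists and is unique, so that [xget]    *)
(* returns <F,x> - b_F; the default value 0 is irrelevant.                    *)
Definition height n (P F : set 'rV[K]_n) (x : 'rV[int]_n) : int :=
  xget 0 [set h | exists (f : {additive 'rV[int]_n -> int}) (b : int),
                    facet_form P F f b /\ h = f x - b].

Definition base_facet n (P : set 'rV[K]_n) (v : 'rV[int]_n)
    (F : set 'rV[K]_n) : Prop :=
  [/\ v != 0, facet P F
    & forall x, lattice_points P x -> ~ F (toR x) -> lattice_points P (x + v)].

Definition Col n (P : set 'rV[K]_n) : set 'rV[int]_n :=
  [set v | exists F, base_facet P v F].

(* Q is P^{square_F}.  The base point x0 in F serves as the origin while      *)
(* doubling: nu is the unit normal of F pointing into P and the matrix M      *)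
(* (acting on the right of row vectors) is the isometric embedding rho.  The  *)
(* renaming of the lattice Z^m + rho(Z^m) to Z^(m+1) is carried out by psi,   *)
(* which leaves R^m = R^m x {0} pointwise fixed, so that P, read as P x {0},  *)
(* is a subset of Q in the new coordinates too.                               *)
Definition doubling m (P F : set 'rV[K]_m) (Q : set 'rV[K]_(m + 1)) : Prop :=
  exists (x0 : 'rV[int]_m) (nu : 'rV[K]_m)
         (M : 'M[K]_(m, m + 1)) (psi : 'M[K]_(m + 1)),
  [/\ F (toR x0),
      [/\ nu *m nu^T = 1%:M,
          forall x, F x -> (x - toR x0) *m nu^T = 0
        & forall x, P x -> 0 <= ((x - toR x0) *m nu^T) 0 0],
      [/\ M *m M^T = 1%:M,
          forall x, F x -> (x - toR x0) *m M = row_mx (x - toR x0) 0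
        & nu *m M = row_mx 0 1%:M],
      [/\ psi \in unitmx,
          forall x : 'rV[K]_m, row_mx x 0 *m psi = row_mx x 0
        & forall z : 'rV[K]_(m + 1),
            (exists x y, z = row_mx (toR x) 0 + toR y *m M) <->
            (exists w, z *m psi = toR w)]
    & Q = [set row_mx (toR x0) 0 + z *m psi | z in
             convex_hull ([set row_mx (x - toR x0) 0 | x in P] `|`
                          [set (x - toR x0) *m M | x in P])]].

Definition doubling_along m (P : set 'rV[K]_m) (v : 'rV[int]_m)
    (Q : set 'rV[K]_(m + 1)) : Prop :=
  exists F, base_facet P v F /\ doubling P F Q.

Fixpoint sdim (n i : nat) : nat := if i is j.+1 then (sdim n j + 1)%N else n.

(* Z^(oo), the union of the chain Z^n < Z^(n+1) < ..., is realised as the     *)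
(* additive group of {poly int}: rVpoly x is the polynomial with coefficients *)
(* x_0, x_1, ..., so that rVpoly (row_mx x 0) = rVpoly x.                     *)
Definition doubling_spectrum_axiom n (P : set 'rV[K]_n)
    (S : forall i, set 'rV[K]_(sdim n i)) : Prop :=
  [/\ S 0%N = P,
      forall i, exists v, Col (S i) v /\ doubling_along (S i) v (S i.+1)
    & forall i v, Col (S i) v -> exists j w,
        [/\ (i <= j)%N, rVpoly w = rVpoly v
          & doubling_along (S j) w (S j.+1)]].

Record doubling_spectrum n (P : set 'rV[K]_n) := DoublingSpectrum {
  chain :> forall i, set 'rV[K]_(sdim n i);
  chainP : doubling_spectrum_axiom P chain
}.

Definition stable_col n (P : set 'rV[K]_n) (S : doubling_spectrum P) :
    set {poly int} :=
  [set u | exists i v, Col (S i) v /\ u = rVpoly v].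

End Polytopes.

(* The library makes {malg R[G]} a ring only for monoids G without nontrivial *)
(* units, hence not for G a group; whence the following.                      *)
Definition monoid_algebra (R : comPzRingType) (G : nmodType) := {malg R[G]}.

Section MonoidAlgebra.
Local Open Scope fset_scope.
Local Open Scope ring_scope.
Variables (R : comPzRingType) (G : nmodType).
Local Notation A := (monoid_algebra R G).
Implicit Types (f g h : A).

HB.instance Definition _ := GRing.Zmodule.on A.

Definition mon (k : G) : A := mkmalgU k 1.

Definition ma_scale (c : R) f : A := \sum_(k <- msupp f) << c * f@_k *g k >>.

Definition ma_mul f g : A :=
  \sum_(k <- msupp f) \sum_(l <- msupp g) << f@_k * g@_l *g (k + l)%R >>.

Lemma ma_scaleE c f k : (ma_scale c f)@_k = c * f@_k.
Proof.
rewrite {2}[f]monalgE !raddf_sum mulr_sumr.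
by apply/eq_bigr=> /= i _; rewrite !mcoeffU mulrnAr.
Qed.

Fact ma_scaleA c1 c2 f : ma_scale c1 (ma_scale c2 f) = ma_scale (c1 * c2) f.
Proof. by apply/malgP=> x; rewrite !ma_scaleE mulrA. Qed.

Fact ma_scale1 : left_id 1 ma_scale.
Proof. by move=> f; apply/malgP=> k; rewrite !ma_scaleE mul1r. Qed.

Fact ma_scaleDr : right_distributive ma_scale +%R.
Proof.
by move=> c f g; apply/malgP=> k; rewrite !(mcoeffD, ma_scaleE) mulrDr.
Qed.

Fact ma_scaleDl f : {morph ma_scale^~ f : c1 c2 / c1 + c2}.
Proof.
by move=> c1 c2; apply/malgP=> x; rewrite !(mcoeffD, ma_scaleE) mulrDl.
Qed.

HB.instance Definition _ := GRing.Zmodule_isLmodule.Build R A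
  ma_scaleA ma_scale1 ma_scaleDr ma_scaleDl.

Lemma ma_mulw (d1 d2 : {fset G}) f g : msupp f `<=` d1 -> msupp g `<=` d2 ->
  ma_mul f g = \sum_(k <- d1) \sum_(l <- d2) << f@_k * g@_l *g (k + l)%R >>.
Proof.
move=> le_d1 le_d2; rewrite /ma_mul (big_fset_incl _ le_d1) /=.
  apply/eq_bigr=> k1 _; apply/big_fset_incl => // k _ /mcoeff_outdom ->.
  by rewrite mulr0 monalgU0.
move=> k _ /mcoeff_outdom fk.
by rewrite big1 => // k' _; rewrite fk mul0r monalgU0.
Qed.

Fact ma_mulC : commutative ma_mul.
Proof.
move=> f g; rewrite /ma_mul exchange_big /=; apply: eq_bigr => k _.
by apply: eq_bigr => l _; rewrite mulrC addrC.
Qed.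

Fact ma_mulDl : left_distributive ma_mul +%R.
Proof.
move=> f1 f2 g; rewrite [in RHS](ma_mulw (fsubsetUl _ (msupp f2)) (fsubset_refl _)).
rewrite [in RHS](ma_mulw (fsubsetUr (msupp f1) _) (fsubset_refl _)).
rewrite (ma_mulw (msuppD_le _ _) (fsubset_refl _)).
rewrite -big_split /=; apply/eq_bigr=> k1 _.
rewrite -big_split /=; apply/eq_bigr=> k2 _.
by rewrite mcoeffD mulrDl monalgUD.
Qed.

Fact ma_mulDr : right_distributive ma_mul +%R.
Proof. by move=> f g h; rewrite ma_mulC ma_mulDl !(ma_mulC f). Qed.

Fact ma_mul0l : left_zero 0 ma_mul.
Proof. by move=> g; rewrite /ma_mul msupp0 big_seq_fset0. Qed.

Fact ma_mulUU c1 c2 k1 k2 :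
  ma_mul << c1 *g k1 >> << c2 *g k2 >> = << c1 * c2 *g (k1 + k2)%R >>.
Proof. by rewrite (ma_mulw msuppU_le msuppU_le) !big_seq_fset1 !mcoeffUU. Qed.

Fact ma_mul1 : left_id (mon 0) ma_mul.
Proof.
move=> g; rewrite (ma_mulw msuppU_le (fsubset_refl _)) big_seq_fset1.
rewrite [RHS]monalgE; apply: eq_bigr => k _.
by rewrite mcoeffUU mul1r add0r.
Qed.

Lemma ma_mul_suml (I : Type) (s : seq I) (F : I -> A) g :
  ma_mul (\sum_(i <- s) F i) g = \sum_(i <- s) ma_mul (F i) g.
Proof.
by apply: (big_morph (ma_mul^~ g) (fun f h => ma_mulDl f h g)); apply: ma_mul0l.
Qed.

Lemma ma_mul_sumr (I : Type) (s : seq I) (F : I -> A) f :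
  ma_mul f (\sum_(i <- s) F i) = \sum_(i <- s) ma_mul f (F i).
Proof.
by rewrite ma_mulC ma_mul_suml; apply: eq_bigr => i _; rewrite ma_mulC.
Qed.

Lemma ma_E f : f = \sum_(k <- msupp f) (<< f@_k *g k >> : A).
Proof. exact: monalgE. Qed.

Fact ma_mulA : associative ma_mul.
Proof.
move=> f g h; rewrite (ma_E f) (ma_E g) (ma_E h).
rewrite ma_mul_suml [in RHS]ma_mul_suml [in RHS]ma_mul_suml.
apply: eq_bigr => i _; rewrite [X in ma_mul _ X]ma_mul_suml.
rewrite ma_mul_sumr [X in ma_mul X _]ma_mul_sumr.
rewrite [RHS]ma_mul_suml; apply: eq_bigr => j _.
rewrite !ma_mul_sumr; apply: eq_bigr => k _.
by rewrite !ma_mulUU mulrA addrA.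
Qed.

HB.instance Definition _ := GRing.Zmodule_isComPzRing.Build A
  ma_mulA ma_mulC ma_mul1 ma_mulDl.

Lemma msupp_ma_mul f g k : k \in msupp (f * g) ->
  exists k1 k2, [/\ k1 \in msupp f, k2 \in msupp g & k = (k1 + k2)%R].
Proof.
move=> kfg; apply: contrapT => nk; move: kfg; rewrite -mcoeff_neq0 => /negP; apply.
rewrite [f * g]/(ma_mul f g) /ma_mul raddf_sum big_seq big1//= => k1 k1f.
rewrite raddf_sum big_seq big1//= => k2 k2g.
rewrite mcoeffU; case: eqP => [kE|//]; case: nk; exists k1, k2; split=> //.
Qed.

End MonoidAlgebra.

Section StableGroup.
Context {K : realType}.
Variable R : comPzRingType.

(* Z^(oo) x Z, which contains the groups Z^(n+i) x Z of all the P_i.          *)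
Local Notation G := ({poly int} * int)%type.
Local Notation A := (monoid_algebra R G).

Definition hpoint n (x : 'rV[int]_n) : G := (rVpoly x, 1).
Definition hvect (u : {poly int}) : G := (u, 0).

(* The empty sum 0 belongs to S_P: it is the unit monomial of R[P]. *)
Definition polytope_semigroup n (P : set 'rV[K]_n) : set G :=
  [set g | exists s : seq 'rV[int]_n,
     {in s, forall x, lattice_points P x} /\ g = \sum_(x <- s) hpoint x].

Definition polytopal_algebra n (P : set 'rV[K]_n) : set A :=
  [set f | {in msupp f, forall g, polytope_semigroup P g}].

Lemma doubling_sub m (P F : set 'rV[K]_m) (Q : set 'rV[K]_(m + 1)) x :
  doubling P F Q -> P x -> Q (row_mx x 0).
Proof.
move=> [x0 [nu [M [psi [_ _ _ [_ psi0 _] ->]]]]] Px /=.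
exists (row_mx (x - toR x0) 0).
  exists 1%N, 1%:M, (row_mx (x - toR x0) 0); split=> [i||i|].
  - by rewrite !ord1 mxE eqxx.
  - by rewrite big_ord1 mxE eqxx.
  - by left; exists x => //; rewrite row_id.
  - by rewrite mul1mx.
by rewrite psi0 add_row_mx addr0 addrC subrK.
Qed.

Lemma rVpoly_row_mx0 m (x : 'rV[int]_m) :
  rVpoly (row_mx x 0 : 'rV_(m + 1)) = rVpoly x.
Proof.
apply/polyP => i; rewrite !coef_rVpoly.
case: insubP => [j _ <-|im1].
  case: (splitP j) => k jk.
    have -> : j = lshift 1 k by apply: val_inj.
    rewrite row_mxEl; case: insubP => [l _ lk|]; last by rewrite /= ltn_ord.
    by congr (x _ _); apply: val_inj; rewrite lk.
  have -> : j = rshift m k by apply: val_inj.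
  rewrite row_mxEr mxE; case: insubP => [l _ lk|//]; have := ltn_ord l.
  by rewrite lk /= ltnNge leq_addr.
case: insubP => [l _ li|//]; case/negP: im1.
by rewrite -li addn1 ltnS ltnW ?ltn_ord.
Qed.

Lemma semigroup_doubling m (P F : set 'rV[K]_m) (Q : set 'rV[K]_(m + 1)) :
  doubling P F Q -> polytope_semigroup P `<=` polytope_semigroup Q.
Proof.
move=> PQ _ [s [sP ->]]; exists [seq row_mx x 0 | x <- s]; split.
  move=> _ /mapP[x /sP Px ->]; rewrite /lattice_points /= /toR map_row_mx map_mx0.
  exact: doubling_sub PQ Px.
by rewrite big_map; apply: eq_bigr => x _; rewrite /hpoint rVpoly_row_mx0.
Qed.

Lemma semigroup_chain n (P : set 'rV[K]_n) (S : doubling_spectrum P) i j :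
  (i <= j)%N -> polytope_semigroup (S i) `<=` polytope_semigroup (S j).
Proof.
elim: j => [|j IH]; first by rewrite leqn0 => /eqP ->.
rewrite leq_eqVlt => /predU1P[->//|/IH sub]; apply: (subset_trans sub).
have [_ /(_ j)[v [_ [F [_ dbl]]]] _] := chainP S.
exact: semigroup_doubling dbl.
Qed.

Lemma semigroup0 n (P : set 'rV[K]_n) : polytope_semigroup P 0.
Proof. by exists [::]; rewrite big_nil. Qed.

Lemma semigroupD n (P : set 'rV[K]_n) g h :
  polytope_semigroup P g -> polytope_semigroup P h -> polytope_semigroup P (g + h).
Proof.
move=> [s [sP ->]] [t [tP ->]]; exists (s ++ t); rewrite big_cat; split=> //.
by move=> x; rewrite mem_cat => /orP[/sP|/tP].
Qed.

(* The direct limit of the R[P_i] is their union inside the group ring A. *)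
Definition stable_mem n (P : set 'rV[K]_n) (S : doubling_spectrum P) : {pred A} :=
  [pred f | `[< exists i, polytopal_algebra (S i) f >]].

Fact stable_subring n (P : set 'rV[K]_n) (S : doubling_spectrum P) :
  subring_closed (stable_mem S).
Proof.
have join f g : f \in stable_mem S -> g \in stable_mem S -> exists i,
    polytopal_algebra (S i) f /\ polytopal_algebra (S i) g.
  have mono k l h : (k <= l)%N ->
      polytopal_algebra (S k) h -> polytopal_algebra (S l) h.
    by move=> kl hk x /hk; exact: semigroup_chain.
  move=> /asboolP[i fi] /asboolP[j gj]; exists (maxn i j).
  by split; [apply: mono fi; exact: leq_maxl | apply: mono gj; exact: leq_maxr].
split=> [|f g fS gS|f g fS gS].
- apply/asboolP; exists 0%N => k; move/(fsubsetP msuppU_le).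
  by rewrite inE => /eqP ->; exact: semigroup0.
- apply/asboolP; have [i [fi gi]] := join _ _ fS gS; exists i => k.
  by move/(fsubsetP (msuppB_le _ _)); rewrite inE => /orP[/fi|/gi].
- apply/asboolP; have [i [fi gi]] := join _ _ fS gS; exists i => k.
  by move/msupp_ma_mul => [k1 [k2 [/fi ? /gi ? ->]]]; exact: semigroupD.
Qed.

Fact stable_scale n (P : set 'rV[K]_n) (S : doubling_spectrum P) :
  GRing.scaler_closed (stable_mem S).
Proof.
move=> c f /asboolP[i fi]; apply/asboolP; exists i => k kcf; apply: fi.
move: kcf; rewrite -!mcoeff_neq0; apply: contra => /eqP fk0.
by rewrite [c *: f]/(ma_scale c f) ma_scaleE fk0 mulr0.
Qed.

Fact stable_submod n (P : set 'rV[K]_n) (S : doubling_spectrum P) :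
  GRing.subsemimod_closed (stable_mem S).
Proof.
split; last exact: stable_scale.
exact: GRing.zmod_closedD (GRing.subring_closedB (stable_subring S)).
Qed.

Section StableAlgebra.
Context {n : nat} {P : set 'rV[K]_n}.
Variable S : doubling_spectrum P.

Record stable_algebra := StableAlgebra {
  stable_val :> A;
  _ : stable_val \in stable_mem S
}.

HB.instance Definition _ := [isSub for stable_val].
HB.instance Definition _ := [Choice of stable_algebra by <:].
HB.instance Definition _ := GRing.SubChoice_isSubComPzRing.Build A _
  stable_algebra (stable_subring S).
HB.instance Definition _ := GRing.SubZmodule_isSubLmodule.Build R A _
  stable_algebra (stable_submod S).

Fact stable_point_subproof i (x : 'rV[int]_(sdim n i)) :
  lattice_points (S i) x -> mon R (hpoint x) \in stable_mem S.
Proof.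
move=> Px; apply/asboolP; exists i => g /(fsubsetP msuppU_le).
rewrite inE => /eqP ->; exists [:: x]; rewrite big_seq1; split=> //.
by move=> y; rewrite inE => /eqP ->.
Qed.

Definition stable_point i (x : 'rV[int]_(sdim n i))
    (Px : lattice_points (S i) x) : stable_algebra :=
  StableAlgebra (stable_point_subproof Px).

Definition algebra_automorphism (f : stable_algebra -> stable_algebra) : Prop :=
  [/\ GRing.monoid_morphism f, linear f & bijective f].

Record stable_aut := StableAut {
  aut_fun :> stable_algebra -> stable_algebra;
  aut_funP : algebra_automorphism aut_fun
}.

HB.instance Definition _ := gen_eqMixin stable_aut.
HB.instance Definition _ := gen_choiceMixin stable_aut.

Lemma stable_autP (f g : stable_aut) : f =1 g -> f = g.
Proof.
case: f g => [f fP] [g gP] /= /funext fg; move: fP gP; rewrite fg => fP gP.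
by congr StableAut; exact: Prop_irrelevance.
Qed.

Fact aut_one_subproof : algebra_automorphism id.
Proof. by split=> //; exists id. Qed.
Definition aut_one := StableAut aut_one_subproof.

Fact aut_mul_subproof (f g : stable_aut) : algebra_automorphism (f \o g).
Proof.
case: f g => [f [[f1 fM] fl fb]] [g [[g1 gM] gl gb]] /=.
split; [split=> [|x y] /= | move=> c x y /= | exact: bij_comp].
- by rewrite g1 f1.
- by rewrite gM fM.
- by rewrite gl fl.
Qed.
Definition aut_mul f g := StableAut (aut_mul_subproof f g).

Fact aut_inv_exists (f : stable_aut) :
  exists g : stable_aut, cancel f g /\ cancel g f.
Proof.
case: f => [f [[f1 fM] fl [g fK gK]]] /=.
suff gP : algebra_automorphism g by exists (StableAut gP).
split; [split=> [|x y] | move=> c x y | by exists f].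
- by rewrite -f1 fK.
- by rewrite -{1}[x]gK -{1}[y]gK -fM fK.
- by rewrite -{1}[x]gK -{1}[y]gK -fl fK.
Qed.
Definition aut_inv f := sval (cid (aut_inv_exists f)).

Fact aut_mulA : associative aut_mul.
Proof. by move=> f g h; exact: stable_autP. Qed.
Fact aut_mul1l : left_id aut_one aut_mul.
Proof. by move=> f; exact: stable_autP. Qed.
Fact aut_mul1r : right_id aut_one aut_mul.
Proof. by move=> f; exact: stable_autP. Qed.
Fact aut_mulVl : left_inverse aut_one aut_inv aut_mul.
Proof.
by move=> f; apply: stable_autP => x /=; rewrite /aut_inv; case: cid => g [].
Qed.
Fact aut_mulVr : right_inverse aut_one aut_inv aut_mul.
Proof.
by move=> f; apply: stable_autP => x /=; rewrite /aut_inv; case: cid => g [].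
Qed.

HB.instance Definition _ := isGroup.Build stable_aut
  aut_mulA aut_mul1l aut_mul1r aut_mulVl aut_mulVr.

(* e is e_u^lam for u in the union of the Col(P_j): for all j >> 0, u comes   *)
(* from a column vector v of P_j, and e maps each x in L_(P_j) to             *)
(* (1 + lam v)^(ht x) x, computed in the group ring of Z^(oo) x Z.            *)
Definition elementary_aut (u : {poly int}) (lam : R) (e : stable_aut) : Prop :=
  exists i, forall j, (i <= j)%N -> exists v F,
    [/\ rVpoly v = u, base_facet (S j) v F
      & forall x (Px : lattice_points (S j) x),
          val (e (stable_point Px)) =
          (1 + lam *: mon R (hvect u)) ^+ `|height (S j) F x|%N
            * mon R (hpoint x)].

End StableAlgebra.

End StableGroup.

Section Groups.
Local Open Scope group_scope.
Context {gT : groupType}.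

Definition subgroup (H : set gT) : Prop :=
  H 1 /\ forall x y, H x -> H y -> H (x * y^-1).

Definition generated_subgroup (X : set gT) : set gT := smallest subgroup X.

Definition center_of (H : set gT) : set gT :=
  [set z | H z /\ forall h, H h -> commute z h].

End Groups.

Definition stable_elementary_group {K : realType} (R : comPzRingType) n
    (P : set 'rV[K]_n) (S : doubling_spectrum P) : set (stable_aut R S) :=
  generated_subgroup
    [set e | exists u lam, stable_col S u /\ elementary_aut u lam e].

Arguments stable_elementary_group {K} R {n P} S _.

(* Main.v *)
(* Every z in the group is a product of e_u^lam with u in a finite set U, and
   U is contained in Col(P_j) for all large j.  Double such a P_j along a base
   facet with height function g: the new lattice points are (x, 0) - k d with
   x in L_(P_j), 0 <= k <= g(x), where d is a new column vector whose base facet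
   is P_j itself, and k is the height above it.  The automorphism z preserves
   the grading by k (extended to the whole spectrum), because the vectors in U
   have degree 0.  The mirror image x' = (x, 0) - g(x) d satisfies
   e_d(x') = (1 + d)^g(x) x', whose part of degree 0 is x; since z commutes with
   e_d, taking the degree 0 part of z(e_d(x')) = e_d(z(x')) gives
   z(x) = d^g(x) z(x').  Now x' lies on the base facet of every column vector of
   P_j based at the doubled facet, and on that of each u for which x does.
   Mirroring repeatedly, x is moved onto the base facets of all u in U, where
   all the factors of z act trivially; hence z(x) = x. *)

From HB Require Import structures.
Require Import Defs.
From mathcomp Require Import all_boot all_order all_algebra.
From mathcomp Require Import finmap.
From mathcomp Require Import boolp classical_sets reals.
From mathcomp.multinomials Require Import monalg.
From mathcomp Require Import ring lra zify.

Set Implicit Arguments.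
Unset Strict Implicit.
Unset Printing Implicit Defensive.

Import Order.TTheory GRing.Theory Num.Theory.

Local Open Scope ring_scope.
Local Open Scope classical_set_scope.

(** * Convex and affine hulls *)

(** Commuting with [e_d] can be used only once [e_d] is known to lie in the group, and
    [elementary_aut] merely describes an automorphism. So [e_d] has to be constructed on the whole
    limit algebra, which takes one additive function on Z^(oo) that at every later level is the
    height above the base facet of d. This shapes the geometry: each doubling must extend the height
    form of a column vector to the new coordinate without touching its old coefficients. The
    constant term starts at 0 and never changes, so the limit is linear and not just affine, hence a
    grading. It vanishes on every coordinate that exists at level j, where the vectors of U live;
    that is why they have degree 0. The metric definition of a doubling is used once, to produce
    integral coordinates in which Q is the set of points (x, 0) - k d with x in P and k between 0
    and the height of x. Everything later works with these inequalities. *)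

Section Hulls.
Context {K : realType}.

Definition convex n (C : set 'rV[K]_n) : Prop :=
  forall x y t, C x -> C y -> 0 <= t -> t <= 1 -> C (t *: x + (1 - t) *: y).

Lemma convex_hull_sub n (A : set 'rV[K]_n) : A `<=` convex_hull A.
Proof.
move=> x Ax; exists 1%N, 1%:M, x; split=> [i||i|].
- by rewrite !ord1 mxE eqxx.
- by rewrite big_ord1 mxE eqxx.
- by rewrite row_id.
- by rewrite mul1mx.
Qed.

Lemma convex_hull_convex n (A : set 'rV[K]_n) : convex (convex_hull A).
Proof.
move=> _ _ t [m [c [X [c0 c1 AX ->]]]] [p [d [Y [d0 d1 AY ->]]]] t0 t1.
exists (m + p)%N, (row_mx (t *: c) ((1 - t) *: d)), (col_mx X Y).
split=> [i||i|].
- case: (splitP i) => j ij.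
    have -> : i = lshift p j by exact: val_inj.
    by rewrite row_mxEl mxE mulr_ge0.
  have -> : i = rshift m j by exact: val_inj.
  by rewrite row_mxEr mxE mulr_ge0 // subr_ge0.
- rewrite big_split_ord /=.
  under eq_bigr do rewrite row_mxEl mxE.
  under [X in _ + X]eq_bigr do rewrite row_mxEr mxE.
  by rewrite -!mulr_sumr c1 d1 !mulr1 addrC subrK.
- case: (splitP i) => j ij.
    have -> : i = lshift p j by exact: val_inj.
    by rewrite rowKu.
  have -> : i = rshift m j by exact: val_inj.
  by rewrite rowKd.
- by rewrite mul_row_col -!scalemxAl.
Qed.

Lemma convex_hull_min n (A C : set 'rV[K]_n) :
  convex C -> A `<=` C -> convex_hull A `<=` C.
Proof.
move=> cC AC _ [m [c [X [c0 c1 AX ->]]]].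
rewrite mulmx_sum_row.
have CX i : C (row i X) by exact: AC.
(* The points are added one at a time: a partial sum divided by its weight stays in [C]. As long as
   the weight is 0, all earlier coefficients vanish. *)
suff H : forall k, (k <= m)%N ->
    let s := \sum_(i < m | (i < k)%N) c 0 i in
    0 < s -> C (s^-1 *: \sum_(i < m | (i < k)%N) c 0 i *: row i X).
  have := H m (leqnn _) => /=.
  under eq_bigl do rewrite ltn_ord.
  under [in X in C (_ *: X)]eq_bigl do rewrite ltn_ord.
  by rewrite c1 invr1 scale1r; apply.
elim=> [|k IH] km /=; first by rewrite big1 ?ltxx // => i.
pose o := Ordinal km.
have split_k (V : zmodType) (F : 'I_m -> V) :
    \sum_(i < m | (i < k.+1)%N) F i = F o + \sum_(i < m | (i < k)%N) F i.
  rewrite (bigD1 o) //=; congr (_ + _); apply: eq_bigl => i.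
  by rewrite ltnS leq_eqVlt -(inj_eq val_inj) /=; case: ltngtP.
rewrite !split_k /=; set s := \sum_(i < m | _) c 0 i.
set Y := \sum_(i < m | _) _ => spos.
have s0 : 0 <= s by apply: sumr_ge0.
move: s0; rewrite le_eqVlt => /predU1P[s0|s0].
  have -> : Y = 0.
    rewrite /Y big1 // => i ik; suff -> : c 0 i = 0 by rewrite scale0r.
    by move: ik; apply: (psumr_eq0P (P := fun i : 'I_m => (i < k)%N)) i.
  rewrite -s0 addr0 addr0 scalerA mulVf ?scale1r //.
  by move: spos; rewrite -s0 addr0; exact: lt0r_neq0.
have CY := IH (ltnW km) s0; rewrite -/s -/Y in CY.
have n0 : c 0 o + s != 0 by exact: lt0r_neq0.
have := cC _ _ (c 0 o / (c 0 o + s)) (CX o) CY.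
have -> : 1 - c 0 o / (c 0 o + s) = s / (c 0 o + s) by field.
have -> : (c 0 o + s)^-1 *: (c 0 o *: row o X + Y) =
    (c 0 o / (c 0 o + s)) *: row o X + (s / (c 0 o + s)) *: (s^-1 *: Y).
  rewrite scalerDr !scalerA [_ * c 0 o]mulrC; congr (_ + _ *: _).
  by field; rewrite n0 lt0r_neq0.
apply.
  by rewrite divr_ge0 // ltW.
by rewrite ler_pdivrMr // mul1r lerDl ltW.
Qed.

Lemma affine_hull_sub n (A : set 'rV[K]_n) : A `<=` affine_hull A.
Proof.
move=> x Ax; exists 1%N, 1%:M, x; split=> [|i|].
- by rewrite big_ord1 mxE eqxx.
- by rewrite row_id.
- by rewrite mul1mx.
Qed.

Lemma affine_hull_combine n (A : set 'rV[K]_n) x y z t :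
  affine_hull A x -> affine_hull A y -> affine_hull A z ->
  affine_hull A (x + t *: (y - z)).
Proof.
move=> [m [c [X [c1 AX ->]]]] [p [d [Y [d1 AY ->]]]] [q [e [Z [e1 AZ ->]]]].
exists (m + (p + q))%N, (row_mx c (row_mx (t *: d) (- t *: e))).
exists (col_mx X (col_mx Y Z)); split=> [|i|].
- rewrite big_split_ord /=.
  under eq_bigr do rewrite row_mxEl.
  under [X in _ + X]eq_bigr do rewrite row_mxEr.
  rewrite big_split_ord /=.
  under [X in _ + (X + _)]eq_bigr do rewrite row_mxEl mxE.
  under [X in _ + (_ + X)]eq_bigr do rewrite row_mxEr mxE.
  by rewrite -!mulr_sumr c1 d1 e1 !mulr1 addrN addr0.
- case: (splitP i) => j ij.
    have -> : i = lshift (p + q) j by exact: val_inj.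
    by rewrite rowKu.
  have -> : i = rshift m j by exact: val_inj.
  rewrite rowKd; case: (splitP j) => l jl.
    have -> : j = lshift q l by exact: val_inj.
    by rewrite rowKu.
  have -> : j = rshift p l by exact: val_inj.
  by rewrite rowKd.
- by rewrite !mul_row_col -!scalemxAl scaleNr scalerBr.
Qed.

Lemma affine_hull_min n p (A : set 'rV[K]_n) (B : 'M[K]_(n, p)) beta :
  (forall x, A x -> x *m B = beta) ->
  forall x, affine_hull A x -> x *m B = beta.
Proof.
move=> AB _ [m [c [X [c1 AX ->]]]]; rewrite -mulmxA mulmx_sum_row.
under eq_bigr do rewrite row_mul AB //.
by rewrite -scaler_suml c1 scale1r.
Qed.

Lemma affine_hull_map n p (A : set 'rV[K]_n) (A' : set 'rV[K]_p)
    (B : 'M[K]_(n, p)) beta :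
  (forall x, A x -> A' (x *m B + beta)) ->
  forall x, affine_hull A x -> affine_hull A' (x *m B + beta).
Proof.
move=> AB _ [m [c [X [c1 AX ->]]]].
exists m, c, (X *m B + \matrix_(i < m) beta); split=> // [i|].
  have -> : row i (X *m B + \matrix_(i < m) beta) = row i X *m B + beta.
    by rewrite -row_mul; apply/rowP=> j; rewrite !mxE.
  exact/AB/AX.
rewrite mulmxDr mulmxA; congr (_ + _).
rewrite [RHS]mulmx_sum_row; under eq_bigr do rewrite rowK.
by rewrite -scaler_suml c1 scale1r.
Qed.

Lemma affine_dim_full n (A : set 'rV[K]_n) :
  affine_dim A n -> affine_hull A = setT.
Proof.
move=> [x0 [B [Bfree ->]]]; apply/seteqP; split=> // x _ /=.
by apply: submx_full; rewrite row_full_unit -row_free_unit.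
Qed.

Lemma rank_hyperplane n (a : 'cV[K]_n) : a != 0 -> (\rank (kermx a)).+1 = n.
Proof.
move=> a0; rewrite mxrank_ker -mxrank_tr rank_rV.
have -> /= : a^T != 0 by rewrite -(inj_eq trmx_inj) trmxK trmx0.
case: n a a0 => [a|n a _]; first by rewrite (flatmx0 a) eqxx.
by rewrite subn1.
Qed.

Lemma exists_on_hyperplane n (a : 'cV[K]_n) b :
  a != 0 -> exists x : 'rV[K]_n, x *m a = b%:M.
Proof.
move=> a0; have /matrix0Pn[i [j aij]] := a0; rewrite !ord1 in aij.
exists ((b / a i 0) *: delta_mx 0 i); apply/rowP => k.
rewrite !ord1 -scalemxAl -rowE mxE mxE mxE eqxx mulr1n.
by rewrite -mulrA mulVf // mulr1.
Qed.

(** Dimension count: the direction space of the hull lies in the kernel of [a], and both have rank n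
    - 1. With [facet_face], a facet is recovered from any nonzero form that is constant on it. *)
Lemma facet_hull n (P F : set 'rV[K]_n) (a : 'cV[K]_n) b :
  facet P F -> a != 0 -> (forall x, F x -> x *m a = b) ->
  affine_hull F = [set x | x *m a = b].
Proof.
move=> [_ [_ [d [_ _ [x0 [B [Bfree FB]]] dn]]]] a0 Fa.
have hullF := affine_hull_min Fa.
have x0F : affine_hull F x0 by rewrite FB /= subrr sub0mx.
have x0a := hullF _ x0F.
have Ba : B *m a = 0.
  apply/row_matrixP => i; rewrite row_mul row0.
  have /hullF : affine_hull F (x0 + row i B) by rewrite FB /= addrC addKr row_sub.
  by rewrite mulmxDl x0a => /(canRL (addKr _)); rewrite addNr.
have Bker : (B <= kermx a)%MS by apply/sub_kermxP.
have eqB : (kermx a <= B)%MS.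
  rewrite -(mxrank_leqif_sup Bker); move: Bfree; rewrite /row_free => /eqP ->.
  by apply/eqP/succn_inj; rewrite dn rank_hyperplane.
apply/seteqP; split=> [x /hullF //|x /= xa]; rewrite FB /=.
apply: submx_trans eqB; apply/sub_kermxP.
by rewrite mulmxBl xa x0a subrr.
Qed.

Lemma facet_face n (P F : set 'rV[K]_n) :
  facet P F -> F = [set x | P x /\ affine_hull F x].
Proof.
move=> [a [c [d [_ FE _ _]]]]; apply/seteqP; split=> x.
  by move=> Fx; split; [move: Fx; rewrite FE => -[] | exact: affine_hull_sub].
move=> [Px Fx]; rewrite FE; split=> //.
rewrite (@affine_hull_min _ _ F a c%:M _ x Fx) ?mxE ?eqxx // => y.
rewrite FE => -[_ <-]; apply/rowP => i.
by rewrite !ord1 !mxE eqxx.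
Qed.

Lemma facet_intro n (P : set 'rV[K]_n) (a : 'cV[K]_n) (b : K) :
  a != 0 -> (forall x, P x -> b <= (x *m a) 0 0) ->
  affine_hull [set x | P x /\ (x *m a) 0 0 = b] = [set x | (x *m a) 0 0 = b] ->
  facet P [set x | P x /\ (x *m a) 0 0 = b].
Proof.
move=> a0 Pa hullE; exists a, b, (\rank (kermx a)); split=> //; last first.
  exact: rank_hyperplane.
have [x0 x0a] := exists_on_hyperplane b a0.
exists x0, (row_base (kermx a)); split; first exact: row_base_free.
rewrite hullE; apply/seteqP; split=> x /=; rewrite eq_row_base.
  move=> xa; apply/sub_kermxP; rewrite mulmxBl x0a; apply/rowP => i.
  by rewrite !ord1 !mxE in xa *; rewrite xa eqxx subrr.
by move/sub_kermxP/eqP; rewrite mulmxBl x0a subr_eq0 => /eqP ->; rewrite mxE eqxx.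
Qed.

End Hulls.

(** * Integral linear forms *)

Section Evaluation.
Variable T : comNzRingType.
Implicit Types (C : nat -> int) (n : nat).

(** The coefficients form an infinite sequence, so that one [C] serves over the integers and over
    [K], and at all levels of the spectrum. *)
Definition ev C n (x : 'rV[T]_n) : T := (x *m \col_i (C i)%:~R) 0 0.

Lemma evD C n (x y : 'rV[T]_n) : ev C (x + y) = ev C x + ev C y.
Proof. by rewrite /ev mulmxDl mxE. Qed.

Lemma evZ C n k (x : 'rV[T]_n) : ev C (k *: x) = k * ev C x.
Proof. by rewrite /ev -scalemxAl mxE. Qed.

Lemma evN C n (x : 'rV[T]_n) : ev C (- x) = - ev C x.
Proof. by rewrite -scaleN1r evZ mulN1r. Qed.

Lemma evB C n (x y : 'rV[T]_n) : ev C (x - y) = ev C x - ev C y.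
Proof. by rewrite evD evN. Qed.

Lemma ev0 C n : ev C (0 : 'rV[T]_n) = 0.
Proof. by rewrite /ev mul0mx mxE. Qed.

Lemma ev_prefix C C' n (x : 'rV[T]_n) :
  (forall i, (i < n)%N -> C i = C' i) -> ev C x = ev C' x.
Proof.
by move=> CC'; rewrite /ev !mxE; apply: eq_bigr => i _; rewrite !mxE CC'.
Qed.

Lemma ev_row_mx C n (x : 'rV[T]_n) (t : 'M[T]_1) :
  ev C (row_mx x t) = ev C x + t 0 0 * (C n)%:~R.
Proof.
rewrite /ev !mxE big_split_ord big_ord1 /=; congr (_ + _).
  by apply: eq_bigr => i _; rewrite row_mxEl !mxE.
by rewrite row_mxEr mxE /= addn0.
Qed.

Lemma ev_delta C n (i : 'I_n) : ev C (delta_mx 0 i : 'rV[T]_n) = (C i)%:~R.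
Proof. by rewrite /ev -rowE !mxE. Qed.

(* Coordinates with z = (base d z, 0) - depth d z *: d, provided that the last *)
(* entry of d is 1 or -1.                                                      *)
Definition depth m (d z : 'rV[T]_(m + 1)) : T :=
  - (d 0 (rshift m 0) * z 0 (rshift m 0)).

Definition base m (d z : 'rV[T]_(m + 1)) : 'rV[T]_m :=
  lsubmx z + depth d z *: lsubmx d.

Lemma depthD m (d x y : 'rV[T]_(m + 1)) : depth d (x + y) = depth d x + depth d y.
Proof. by rewrite /depth !mxE; ring. Qed.

Lemma depthZ m k (d x : 'rV[T]_(m + 1)) : depth d (k *: x) = k * depth d x.
Proof. by rewrite /depth !mxE; ring. Qed.

Lemma depth_row0 m (d : 'rV[T]_(m + 1)) x : depth d (row_mx x 0) = 0.
Proof. by rewrite /depth row_mxEr mxE mulr0 oppr0. Qed.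

Lemma baseD m (d x y : 'rV[T]_(m + 1)) : base d (x + y) = base d x + base d y.
Proof.
rewrite /base depthD scalerDl addrACA; congr (_ + _).
by apply/rowP => i; rewrite !mxE.
Qed.

Lemma baseZ m k (d x : 'rV[T]_(m + 1)) : base d (k *: x) = k *: base d x.
Proof.
rewrite /base depthZ scalerDr scalerA; congr (_ + _).
by apply/rowP => i; rewrite !mxE.
Qed.

Lemma base_row0 m (d : 'rV[T]_(m + 1)) x : base d (row_mx x 0) = x.
Proof. by rewrite /base depth_row0 scale0r addr0 row_mxKl. Qed.

Section Sign.
Variables (m : nat) (d : 'rV[T]_(m + 1)).
Hypothesis d2 : d 0 (rshift m 0) * d 0 (rshift m 0) = 1.

Lemma depth_dir : depth d d = -1. Proof. by rewrite /depth d2. Qed.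

Lemma base_dir : base d d = 0.
Proof. by rewrite /base depth_dir scaleN1r addrN. Qed.

Lemma base_depthE z : z = row_mx (base d z) 0 - depth d z *: d.
Proof.
rewrite -[LHS]hsubmxK -[X in _ - _ *: X]hsubmxK.
rewrite scale_row_mx opp_row_mx add_row_mx.
rewrite /base addrK; congr row_mx; apply/matrixP=> i j.
by rewrite !ord1 !mxE /depth add0r mulNr opprK mulrAC d2 mul1r.
Qed.

Lemma depth_sub x k : depth d (row_mx x 0 - k *: d) = k.
Proof. by rewrite depthD -scaleNr depthZ depth_row0 depth_dir add0r mulrN1 opprK. Qed.

Lemma base_sub x k : base d (row_mx x 0 - k *: d) = x.
Proof. by rewrite baseD -scaleNr baseZ base_row0 base_dir scaler0 addr0. Qed.

End Sign.

End Evaluation.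

HB.instance Definition _ C n :=
  GRing.isZmodMorphism.Build 'rV[int]_n int (@ev int C n) (@evB int C n).

Section RealPoints.
Context {K : realType}.
Local Notation toR := (@toR K _).

Lemma ev_toR C n (x : 'rV[int]_n) : ev C (toR x) = (ev C x)%:~R.
Proof.
rewrite /ev !mxE rmorph_sum; apply: eq_bigr => i _.
by rewrite !mxE rmorphM /= intz.
Qed.

Lemma toRD n (x y : 'rV[int]_n) : toR (x + y) = toR x + toR y.
Proof. exact: map_mxD. Qed.

Lemma toRN n (x : 'rV[int]_n) : toR (- x) = - toR x.
Proof. exact: map_mxN. Qed.

Lemma toRZ n k (x : 'rV[int]_n) : toR (k *: x) = k%:~R *: toR x.
Proof. exact: map_mxZ. Qed.

Lemma toR_row_mx m (x : 'rV[int]_m) (t : 'M[int]_1) :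
  toR (row_mx x t) = row_mx (toR x) (map_mx intr t).
Proof. exact: map_row_mx. Qed.

Lemma toR_row0 m (x : 'rV[int]_m) :
  toR (row_mx x 0 : 'rV_(m + 1)) = row_mx (toR x) 0.
Proof. by rewrite toR_row_mx map_mx0. Qed.

Lemma depth_toR m (d z : 'rV[int]_(m + 1)) :
  depth (toR d) (toR z) = (depth d z)%:~R.
Proof. by rewrite /depth rmorphN rmorphM /= !mxE. Qed.

Lemma base_toR m (d z : 'rV[int]_(m + 1)) :
  base (toR d) (toR z) = toR (base d z).
Proof.
rewrite /base toRD toRZ -depth_toR /toR; congr (_ + _ *: _).
  by apply/rowP=> i; rewrite !mxE.
by apply/rowP=> i; rewrite !mxE.
Qed.

Lemma col_form_neq0 C n (v : 'rV[int]_n) :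
  ev C v != 0 -> (\col_(i < n) (C i)%:~R : 'cV[K]_n) != 0.
Proof.
move=> Cv; apply: contra_neq Cv => C0; apply/eqP.
by rewrite -(intr_eq0 K) -ev_toR /ev C0 mulmx0 mxE.
Qed.

End RealPoints.

(* Both sides are additive, and v generates a complement of the kernel of C.  *)
Lemma integral_form_unique n (f : {additive 'rV[int]_n -> int}) C (b b' : int)
    (v x1 y1 : 'rV[int]_n) :
  ev C v = -1 -> (forall y, ev C y = b -> f y = b') -> f y1 = b' + 1 ->
  b < ev C x1 -> b' <= f x1 -> forall y, f y - b' = ev C y - b.
Proof.
move=> Cv Cf fy1 bx1 fx1.
have fE y : f y = b' - (ev C y - b) * f v.
  have := Cf (y + (ev C y - b) *: v).
  rewrite evD evZ Cv mulrN1 opprB addrC subrK => /(_ erefl).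
  rewrite raddfD -[(ev C y - b)]intz scaler_int raddfMz /=.
  by rewrite -mulrzl intz => <-; rewrite addrK.
(* Reaching the value b' + 1 at [y1] forces [f v] to divide 1; the point [x1], on the positive side
   for both forms, decides the sign. *)
have fv : f v = -1.
  have fx1' := fE x1; have := fE y1; rewrite fy1.
  move: (ev C y1 - b) (f v) (f x1) (ev C x1) bx1 fx1 fx1' => t s fx cx bx1 fx1 fx1'.
  move=> ts.
  have s_le0 : s <= 0 by nia.
  have ts' : t * s = -1 by lia.
  have t_gt0 : 0 < t by nia.
  nia.
by move=> y; rewrite fE fv; ring.
Qed.

(** * Column vectors and heights *)

Section Polytopes.
Context {K : realType}.
Local Notation toR := (@toR K _).

Definition full_polytope n (P : set 'rV[K]_n) : Prop :=
  (exists s : seq 'rV[int]_n, P = convex_hull [set toR x | x in [set` s]])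
  /\ affine_hull P = setT.

Lemma full_polytope_convex n (P : set 'rV[K]_n) : full_polytope P -> convex P.
Proof. by move=> [[s ->] _]; exact: convex_hull_convex. Qed.

Lemma full_polytope_min n (P C : set 'rV[K]_n) : full_polytope P -> convex C ->
  (forall x, lattice_points P x -> C (toR x)) -> P `<=` C.
Proof.
move=> [[s Ps] _] cC PC x; rewrite {1}Ps; apply: convex_hull_min => //.
move=> _ /= [y ys <-]; apply: PC; rewrite /lattice_points /= Ps.
by apply: convex_hull_sub; exists y.
Qed.

Lemma full_polytope_bounded n (P : set 'rV[K]_n) : full_polytope P ->
  exists B : K, forall x i, P x -> `|x 0 i| <= B.
Proof.
move=> [[s Ps] _].
exists (\sum_(y <- s) \sum_j `|toR y 0 j|) => x i; rewrite Ps.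
apply: (@convex_hull_min _ _ _ [set x | `|x 0 i| <= _]) => [y z t /= yB zB t0 t1|].
  rewrite !mxE; apply: le_trans (ler_normD _ _) _; rewrite !normrM.
  rewrite (ger0_norm t0) (ger0_norm (_ : 0 <= 1 - t)) ?subr_ge0 //.
  set B := \sum_(y <- s) _ in yB zB *.
  have -> : B = t * B + (1 - t) * B by ring.
  by apply: lerD; apply: ler_wpM2l => //; rewrite subr_ge0.
move=> _ [y /= ys <-]; rewrite (big_rem y ys) /= (bigD1 i) //= -addrA lerDl.
by rewrite addr_ge0 ?sumr_ge0 // => j _; rewrite sumr_ge0.
Qed.

Lemma ev_convex C n (x y : 'rV[K]_n) t :
  ev C (t *: x + (1 - t) *: y) = t * ev C x + (1 - t) * ev C y.
Proof. by rewrite evD !evZ. Qed.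

(** A form constant on P is constant on the affine hull, which is the whole space, and is therefore
    zero; [v] witnesses that it is not. *)
Lemma full_polytope_off n (P : set 'rV[K]_n) C (b : int) (v : 'rV[int]_n) :
  full_polytope P -> ev C v != 0 -> (forall x, P x -> b%:~R <= ev C x) ->
  exists x, lattice_points P x /\ b < ev C x.
Proof.
move=> polP Cv Pb; apply: contrapT => nex.
have Pcst x : P x -> ev C x = b%:~R.
  apply: (@full_polytope_min _ _ [set x | ev C x = _]) => // [y z t /= yb zb _ _|y Py /=].
    by rewrite ev_convex yb zb; ring.
  apply/eqP; rewrite eq_le Pb // andbT ev_toR ler_int leNgt.
  by apply/negP => by'; apply: nex; exists y.
have hull_cst (x : 'rV[K]_n) : ev C x = b%:~R.
  have : affine_hull P x by have [_ ->] := polP.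
  move=> /(@affine_hull_min _ _ _ _ (\col_i (C i)%:~R) b%:~R%:M) H.
  rewrite /ev H ?mxE ?eqxx // => y /Pcst Cy.
  by apply/rowP => i; rewrite !ord1 [RHS]mxE eqxx mulr1n -Cy.
move/eqP: Cv; apply; apply: (@intr_inj K).
by rewrite -ev_toR hull_cst -(hull_cst 0) ev0.
Qed.

(* v is a column vector, and the integral affine form ev C - b is the height  *)
(* above its base facet.                                                      *)
Definition column_form n (P : set 'rV[K]_n) (v : 'rV[int]_n) (C : nat -> int)
    (b : int) : Prop :=
  [/\ forall x, P x -> b%:~R <= ev C x,
      ev C v = -1,
      forall x, lattice_points P x -> b < ev C x -> lattice_points P (x + v)
    & affine_hull [set x | P x /\ ev C x = b%:~R] = [set x | ev C x = b%:~R]].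

Lemma column_form_base_facet n (P : set 'rV[K]_n) v C b :
  column_form P v C b -> base_facet P v [set x | P x /\ ev C x = b%:~R].
Proof.
move=> [Pb Cv Pv hullF]; split.
- by apply: contra_eq_neq Cv => ->; rewrite ev0.
- apply: facet_intro => //; apply: (col_form_neq0 (v := v)).
  by rewrite Cv.
move=> x Px nF; apply: Pv => //; rewrite lt_neqAle -(ler_int K) -ev_toR Pb // andbT.
apply/eqP => Cx; apply: nF; split=> //=; by rewrite ev_toR Cx.
Qed.

Lemma column_form_height n (P : set 'rV[K]_n) v C b x :
  full_polytope P -> column_form P v C b ->
  height P [set x | P x /\ ev C x = b%:~R] x = ev C x - b.
Proof.
move=> polP [Pb Cv Pv hullF].
set F := [set x | _].
have [x1 [Px1 bx1]] : exists x, lattice_points P x /\ b < ev C x.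
  by apply: (full_polytope_off (v := v) polP) => //; rewrite Cv.
have [x2 [Px2 bx2]] : exists x, lattice_points P x /\ ev C x = b.
  (* Each addition of [v] lowers the height by 1, so walking down from [x1] ends at a lattice point
     of the facet. That point fixes the constant of any facet form. *)
  have descend : forall k : nat, k%:Z <= ev C x1 - b ->
      lattice_points P (x1 + k%:Z *: v).
    elim=> [|k IH] kb; first by rewrite scale0r addr0.
    rewrite -[k.+1]addn1 PoszD scalerDl scale1r addrA.
    have kb' : k%:Z < ev C x1 - b by lia.
    by apply: Pv; [exact/IH/ltW | rewrite evD evZ Cv; lia].
  exists (x1 + (ev C x1 - b) *: v); split; last by rewrite evD evZ Cv; lia.
  by case: (ev C x1 - b) (subr_gt0 b (ev C x1)) descend; rewrite bx1 // => k _; exact.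
have form_exists : facet_form P F (@ev int C n) b.
  split.
  - by move=> k; exists (- k *: v); rewrite /= evZ Cv mulrNN mulr1.
  - move=> y z; rewrite hullF /= !ev_toR => /intr_inj Cy /intr_inj Cz.
    by rewrite evB Cy Cz subrr.
  - by move=> y Py; rewrite -(ler_int K) -ev_toR Pb.
  - by move=> y Py [_]; rewrite ev_toR => /intr_inj.
rewrite /height; case: xgetP => [h -> [f [b' [[fsurj fF fP fPF] ->]]] | nform].
  have [y1 fy1] := fsurj (b' + 1).
  apply: (integral_form_unique Cv _ fy1 bx1 (fP _ Px1)) => y Cy.
  rewrite -(fPF x2) //; last by split=> //=; rewrite ev_toR bx2.
  apply/eqP; rewrite -subr_eq0 -raddfB; apply/eqP/fF; rewrite hullF /= ev_toR.
    by rewrite Cy.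
  by rewrite bx2.
by case: (nform (ev C x - b)); exists (@ev int C n), b.
Qed.

End Polytopes.

(** * Doublings *)

Section Doubled.
Context {K : realType}.
Local Notation toR := (@toR K _).
Variables (m : nat) (P : set 'rV[K]_m) (Q : set 'rV[K]_(m + 1)).
Variables (C : nat -> int) (b : int) (dir : 'rV[int]_(m + 1)).

(* ev C - b is the height above the doubled facet, and dir is the column      *)
(* vector of Q that points from rho(P) back to P.                             *)
Definition doubled_form : Prop :=
  [/\ forall x, P x -> b%:~R <= ev C x,
      dir 0 (rshift m 0) * dir 0 (rshift m 0) = 1,
      exists y : 'rV[int]_m, ev C y = 1
    & forall z, Q z <-> [/\ P (base (toR dir) z), 0 <= depth (toR dir) z
                          & depth (toR dir) z <= ev C (base (toR dir) z) - b%:~R]].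

Hypothesis PQ : doubled_form.

Let d2 : dir 0 (rshift m 0) * dir 0 (rshift m 0) = 1.
Proof. by have [] := PQ. Qed.

Let dR2 : toR dir 0 (rshift m 0) * toR dir 0 (rshift m 0) = 1.
Proof. by rewrite !mxE -rmorphM d2. Qed.

Let Pb x : P x -> b%:~R <= ev C x.
Proof. by have [H _ _ _] := PQ; exact: H. Qed.

Let QE z : Q z <-> [/\ P (base (toR dir) z), 0 <= depth (toR dir) z
                          & depth (toR dir) z <= ev C (base (toR dir) z) - b%:~R].
Proof. by have [_ _ _ H] := PQ; exact: H. Qed.

Lemma doubled_lattice z : lattice_points Q z <->
  [/\ lattice_points P (base dir z), 0 <= depth dir z
    & depth dir z <= ev C (base dir z) - b].
Proof.
rewrite {1}/lattice_points /= QE base_toR depth_toR ev_toR.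
by rewrite ler0z -intrB ler_int.
Qed.

Lemma doubled_row0 x : Q (row_mx x 0) <-> P x.
Proof.
rewrite QE base_row0 depth_row0 lexx; split=> [[]//|Px].
by split=> //; rewrite subr_ge0 Pb.
Qed.

Lemma doubled_lattice_row0 x : lattice_points Q (row_mx x 0) <-> lattice_points P x.
Proof. by rewrite /lattice_points /= toR_row0 doubled_row0. Qed.

Lemma doubled_sub x k : P x -> 0 <= k -> k <= ev C x - b%:~R ->
  Q (row_mx x 0 - k *: toR dir).
Proof. by move=> Px k0 kx; rewrite QE base_sub ?depth_sub. Qed.

Lemma doubled_convex : convex P -> convex Q.
Proof.
move=> cP y z t /QE[Py y0 yC] /QE[Pz z0 zC] t0 t1.
rewrite QE baseD !baseZ depthD !depthZ; split.
- exact: cP.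
- by rewrite addr_ge0 ?mulr_ge0 // subr_ge0.
- rewrite evD !evZ.
  have -> : t * ev C (base (toR dir) y) + (1 - t) * ev C (base (toR dir) z)
    - b%:~R = t * (ev C (base (toR dir) y) - b%:~R)
              + (1 - t) * (ev C (base (toR dir) z) - b%:~R) by ring.
  by rewrite lerD // ler_wpM2l // subr_ge0.
Qed.

Lemma doubled_off : full_polytope P -> exists x, lattice_points P x /\ b < ev C x.
Proof.
move=> polP; have [_ _ [y Cy] _] := PQ.
by apply: (full_polytope_off (v := y)); rewrite ?Cy.
Qed.

Lemma doubled_full : full_polytope P -> full_polytope Q.
Proof.
move=> polP; split; last first.
  apply/seteqP; split=> // z _.
  have hull0 (x : 'rV[K]_m) : affine_hull Q (row_mx x 0).
    have : affine_hull P x by have [_ ->] := polP.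
    move=> /(@affine_hull_map _ _ _ _ Q (row_mx 1%:M 0) 0) H.
    have := H _; rewrite mul_mx_row mulmx1 mulmx0 addr0; apply=> y Py.
    by rewrite mul_mx_row mulmx1 mulmx0 addr0; apply/doubled_row0.
  (* A point of positive height supplies the direction [dir] to the hull, as the difference between
     (x, 0) and its mirror image. *)
  have [x [Px bx]] := doubled_off polP.
  have g0 : 0 < ev C (toR x) - b%:~R by rewrite subr_gt0 ev_toR ltr_int.
  rewrite (base_depthE dR2 z) /=.
  have := @affine_hull_combine _ _ Q (row_mx (base (toR dir) z) 0) (row_mx (toR x) 0)
     (row_mx (toR x) 0 - (ev C (toR x) - b%:~R) *: toR dir)
     (- (depth (toR dir) z / (ev C (toR x) - b%:~R))).
  rewrite subKr scalerA mulNr divfK ?lt0r_neq0 // scaleNr; apply=> //.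
  by apply: affine_hull_sub; apply: doubled_sub => //; rewrite ltW.
have [[s Ps] _] := polP.
pose top (x : 'rV[int]_m) := row_mx x 0 - (ev C x - b) *: dir.
exists ([seq row_mx x 0 | x <- s] ++ [seq top x | x <- s]).
have sP x : x \in s -> lattice_points P x.
  by move=> xs; rewrite /lattice_points /= Ps; apply: convex_hull_sub; exists x.
apply/seteqP; split=> [z|]; last first.
  apply: convex_hull_min; first exact: doubled_convex (full_polytope_convex polP).
  move=> _ /= [y ys <-]; rewrite -/(lattice_points Q y).
  move: ys; rewrite mem_cat => /orP[] /mapP[x /sP Px ->].
    exact/doubled_lattice_row0.
  apply/doubled_lattice; rewrite base_sub // depth_sub //; split=> //.
  by rewrite subr_ge0 -(ler_int K) -ev_toR Pb.
set H := convex_hull _ => /QE[Pz z0 zC].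
(* An affine map: it takes x to the point a fraction [t] of the way from (x, 0) to its mirror image.
   It need be checked only on [s], and each z of Q is a slice of its base, with t = depth / height,
   or t = 0 where the height is 0. *)
pose slice t x := row_mx x 0 - (t * (ev C x - b%:~R)) *: toR dir.
have sliceH t : 0 <= t -> t <= 1 -> forall x, P x -> H (slice t x).
  move=> t0 t1 x; rewrite Ps; apply: (@convex_hull_min _ _ _ (fun x => H (slice t x))).
    move=> y1 y2 r H1 H2 r0 r1.
    have -> : slice t (r *: y1 + (1 - r) *: y2) =
        r *: slice t y1 + (1 - r) *: slice t y2.
      rewrite /slice evD !evZ; apply/rowP=> i; rewrite !mxE.
      by case: splitP => j _; rewrite !mxE; ring.
    exact: convex_hull_convex.
  move=> _ [y ys <-].
  have memX (A B : seq 'rV[int]_(m + 1)) (w : 'rV[int]_(m + 1)) :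
    w \in A \/ w \in B <-> [set` A ++ B] w by rewrite /= mem_cat; split=> /orP.
  have -> : slice t (toR y) = t *: toR (top y) + (1 - t) *: toR (row_mx y 0).
    rewrite /top toRD toRN toRZ !toR_row0 intrB -ev_toR /slice.
    by apply/rowP=> i; rewrite !mxE; case: splitP => j _; rewrite ?mxE; ring.
  apply: convex_hull_convex => //; apply: convex_hull_sub.
    by exists (top y) => //; apply/memX; right; exact: (map_f top).
  by exists (row_mx y 0) => //; apply/memX; left; exact: (map_f (fun x => row_mx x 0)).
rewrite (base_depthE dR2 z).
set x := base _ z in Pz zC *; set k := depth _ z in z0 zC *.
have [g0|g0] := ltrP 0 (ev C x - b%:~R).
  have := sliceH (k / (ev C x - b%:~R)) _ _ x Pz; rewrite /slice divfK ?lt0r_neq0 //.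
  by apply; [rewrite divr_ge0 // ltW | rewrite ler_pdivrMr // mul1r].
have -> : k = 0 by apply/eqP; rewrite eq_le z0 (le_trans zC g0).
by have := sliceH 0 (lexx 0) ler01 x Pz; rewrite /slice mul0r.
Qed.

(** The form is [depth]: P is the facet of Q at depth 0, and [dir] lowers the depth by 1. This is
    the seed of the grading. *)
Lemma doubled_start : full_polytope P -> exists C',
  column_form Q dir C' 0 /\ forall i, (i < m)%N -> C' i = 0.
Proof.
move=> polP; pose C' i : int := if i == m then - dir 0 (rshift m 0) else 0.
have C'm i : (i < m)%N -> C' i = 0 by rewrite /C'; case: ltngtP.
have C'0 (T : comNzRingType) (x : 'rV[T]_m) : ev C' x = 0.
  by rewrite /ev !mxE big1 // => i _; rewrite !mxE C'm ?mulr0.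
have C'E (z : 'rV[K]_(m + 1)) : ev C' z = depth (toR dir) z.
  rewrite -[in LHS](hsubmxK z) ev_row_mx C'0 add0r /C' eqxx /depth !mxE.
  by rewrite rmorphN mulrN mulrC.
have C'Z (z : 'rV[int]_(m + 1)) : ev C' z = depth dir z.
  by apply: (@intr_inj K); rewrite -ev_toR -depth_toR C'E.
exists C'; split=> //; split.
- by move=> z /QE[_ z0 _]; rewrite C'E.
- by rewrite C'Z depth_dir.
- move=> z /doubled_lattice[Pz z0 zC]; rewrite C'Z => z1.
  apply/doubled_lattice; rewrite baseD base_dir // addr0 depthD depth_dir //.
  by split=> //; lia.
apply/seteqP; split=> z /=.
  move=> /(@affine_hull_min _ _ _ _ (\col_i (C' i)%:~R) 0) H.
  rewrite /ev H ?mxE // => y [_ Cy].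
  by apply/rowP => i; rewrite !ord1 [RHS]mxE; exact: Cy.
rewrite C'E mulr0z => zd; rewrite (base_depthE dR2 z) zd scale0r subr0.
have : affine_hull P (base (toR dir) z) by have [_ ->] := polP.
move=> /(@affine_hull_map _ _ _ _ [set x | Q x /\ ev C' x = 0] (row_mx 1%:M 0) 0) H.
have := H _; rewrite mul_mx_row mulmx1 mulmx0 addr0; apply=> y Py.
rewrite mul_mx_row mulmx1 mulmx0 addr0; split; first exact/doubled_row0.
by rewrite C'E depth_row0.
Qed.

End Doubled.

(** * Column vectors under a doubling *)

Section DoubledColumns.
Context {K : realType}.
Local Notation toR := (@toR K _).
Variables (m : nat) (P : set 'rV[K]_m) (Q : set 'rV[K]_(m + 1)).
Variables (C : nat -> int) (b : int) (dir : 'rV[int]_(m + 1)).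
Hypotheses (PQ : doubled_form P Q C b dir) (polP : full_polytope P).

Let d2 : dir 0 (rshift m 0) * dir 0 (rshift m 0) = 1.
Proof. by have [] := PQ. Qed.

Let dR2 : toR dir 0 (rshift m 0) * toR dir 0 (rshift m 0) = 1.
Proof. by rewrite !mxE -rmorphM d2. Qed.

Let Pb x : P x -> b%:~R <= ev C x.
Proof. by have [H _ _ _] := PQ; exact: H. Qed.

Lemma hyperplane_ev C' n (x : 'rV[K]_n) (c : K) :
  ev C' x = c <-> x *m (\col_i (C' i)%:~R) = c%:M.
Proof.
split=> [<-|xc]; last by rewrite /ev xc mxE eqxx.
by apply/rowP => i; rewrite !ord1 [RHS]mxE eqxx mulr1n.
Qed.

Lemma facet_hull_ev n (P' F : set 'rV[K]_n) C' c (v : 'rV[int]_n) :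
  facet P' F -> ev C' v != 0 -> (forall x, F x -> ev C' x = c) ->
  affine_hull F = [set x | ev C' x = c].
Proof.
move=> facF Cv Fc.
have -> : [set x : 'rV[K]_n | ev C' x = c] = [set x | x *m (\col_i (C' i)%:~R) = c%:M].
  by apply/seteqP; split=> x /= /hyperplane_ev.
apply: (facet_hull facF); first exact: (col_form_neq0 (v := v)).
by move=> x /Fc /hyperplane_ev.
Qed.

Let G := [set x | P x /\ ev C x = b%:~R].
Hypothesis facG : facet P G.

Let hullG : affine_hull G = [set x | ev C x = b%:~R].
Proof.
have [_ _ [y Cy] _] := PQ.
by apply: (facet_hull_ev facG (v := y)); [rewrite Cy | move=> x []].
Qed.

Section Step.
Variables (u : 'rV[int]_m) (H : nat -> int) (a : int).
Hypothesis colu : column_form P u H a.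

Let F := [set x | P x /\ ev H x = a%:~R].
Let Pa x : P x -> a%:~R <= ev H x. Proof. by have [Q1 _ _ _] := colu; exact: Q1. Qed.
Let Hu : ev H u = -1. Proof. by have [] := colu. Qed.
Let Hu0 : ev H u != 0. Proof. by rewrite Hu. Qed.
Let hullF : affine_hull F = [set x | ev H x = a%:~R]. Proof. by have [] := colu. Qed.
Let Pu x : lattice_points P x -> a < ev H x -> lattice_points P (x + u).
Proof. by have [_ _ Q1 _] := colu; exact: Q1. Qed.

(** [H] continued to the new coordinate so as to take the value [t] at [dir]; the last coefficient
    is the solution of that equation. *)
Let extend (t : int) i : int :=
  if i == m then - (dir 0 (rshift m 0) * (ev H (lsubmx dir) - t)) else H i.

Let extend_low t i : (i < m)%N -> extend t i = H i.
Proof. by rewrite /extend; case: ltngtP. Qed.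

Let extendZ t (z : 'rV[int]_(m + 1)) :
  ev (extend t) z = ev H (base dir z) - t * depth dir z.
Proof.
rewrite -[in LHS](hsubmxK z) ev_row_mx /base evD evZ.
rewrite (ev_prefix _ (extend_low t)) /extend eqxx /depth !mxE intz.
by ring.
Qed.

Let extendR t (z : 'rV[K]_(m + 1)) :
  ev (extend t) z = ev H (base (toR dir) z) - t%:~R * depth (toR dir) z.
Proof.
rewrite -[in LHS](hsubmxK z) ev_row_mx /base evD evZ.
rewrite (ev_prefix _ (extend_low t)) /extend eqxx /depth !mxE.
rewrite rmorphN rmorphM rmorphB /= -ev_toR.
have -> : toR (lsubmx dir) = lsubmx (toR dir) by apply/rowP=> i; rewrite !mxE.
by ring.
Qed.

Let hull_extend t : (forall z, ev (extend t) z = a%:~R ->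
    affine_hull [set z | Q z /\ ev (extend t) z = a%:~R] z) ->
  affine_hull [set z | Q z /\ ev (extend t) z = a%:~R] =
  [set z | ev (extend t) z = a%:~R].
Proof.
move=> H1; apply/seteqP; split=> z /=; last exact: H1.
move=> Qz; apply/hyperplane_ev; move: z Qz.
by apply: affine_hull_min => y [_ /hyperplane_ev].
Qed.

(** Both forms are primitive, since [H] takes the value -1 at [u] and [C] takes the value 1. Sharing
    a hyperplane and a side, they agree; the origin and the basis vectors then compare constants and
    coefficients. *)
Lemma same_facet_form : F = G -> a = b /\ forall i, (i < m)%N -> C i = H i.
Proof.
move=> FG.
have [x1 [Px1 ax1]] : exists x, lattice_points P x /\ a < ev H x.
  exact: full_polytope_off polP Hu0 Pa.
have [_ _ [y Cy] _] := PQ.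
have CH : forall x : 'rV[int]_m, ev C x - b = ev H x - a.
  apply: (integral_form_unique (f := @ev int C m) (y1 := (b + 1) *: y) Hu _ _ ax1).
  - move=> x Hx; apply: (@intr_inj K); rewrite -ev_toR.
    have : affine_hull F (toR x) by rewrite hullF /= ev_toR Hx.
    by rewrite FG hullG.
  - by rewrite /= evZ Cy mulr1.
  - by rewrite -(ler_int K) -ev_toR Pb.
have ab : a = b by have := CH 0; rewrite !ev0 !sub0r => /oppr_inj.
split=> // i im; have := CH (delta_mx 0 (Ordinal im)).
by rewrite !ev_delta !intz ab /= => /addIr.
Qed.

(** If [u] is based at the doubled facet, its new base facet is the mirror copy of P and the depth
    is subtracted from the height (value 1 at [dir]). Otherwise the new base facet is the part of Q
    above F and the depth does not enter (value 0). *)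
Lemma doubled_step : exists H',
  column_form Q (row_mx u 0) H' a /\ forall i, (i < m)%N -> H' i = H i.
Proof.
have hull0 z : affine_hull F (base (toR dir) z) -> forall t,
    affine_hull [set z | Q z /\ ev (extend t) z = a%:~R]
      (row_mx (base (toR dir) z) 0).
  move=> + t.
  move=> /(@affine_hull_map _ _ _ _ [set x | Q x /\ ev (extend t) x = a%:~R]
            (row_mx 1%:M 0) 0) HH.
  have := HH _; rewrite mul_mx_row mulmx1 mulmx0 addr0; apply=> y [Py Hy].
  rewrite mul_mx_row mulmx1 mulmx0 addr0; split; first exact/(doubled_row0 PQ).
  by rewrite extendR depth_row0 base_row0 mulr0 subr0.
have ext_u t : ev (extend t) (row_mx u 0 : 'rV_(m + 1)) = -1.
  by rewrite extendZ depth_row0 base_row0 mulr0 subr0.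
have [FG|nFG] := pselect (F = G).
  have [ab CH] := same_facet_form FG.
  have HR (x : 'rV[K]_m) : ev H x = ev C x by apply: ev_prefix => i /CH ->.
  have HZ (x : 'rV[int]_m) : ev H x = ev C x by apply: ev_prefix => i /CH ->.
  exists (extend 1); split; last exact: extend_low.
  have [_ _ _ QE] := PQ.
  split=> // [z /QE[Pz z0 zC]|z|].
  - by rewrite extendR mul1r HR ab; lra.
  - rewrite extendZ mul1r => /(doubled_lattice PQ)[Pz z0 zC] za.
    apply/(doubled_lattice PQ); rewrite baseD base_row0 depthD depth_row0 addr0.
    split=> //; first by apply: Pu => //; lia.
    by rewrite evD -(HZ u) Hu -HZ -ab; lia.
  apply: hull_extend => z; rewrite extendR mul1r => za.
  rewrite (base_depthE dR2 z).
  have -> : depth (toR dir) z = ev C (base (toR dir) z) - b%:~R.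
    by rewrite -HR -ab -za; ring.
  have : affine_hull P (base (toR dir) z) by have [_ ->] := polP.
  pose B : 'M[K]_(m, m + 1) := row_mx 1%:M 0 - (\col_i (C i)%:~R) *m toR dir.
  move=> /(@affine_hull_map _ _ _ _ [set x | Q x /\ ev (extend 1) x = a%:~R]
            B (b%:~R *: toR dir)).
  have BE x : x *m B + b%:~R *: toR dir = row_mx x 0 - (ev C x - b%:~R) *: toR dir.
    rewrite mulmxBr mul_mx_row mulmx1 mulmx0 mulmxA.
    have -> : x *m \col_i (C i)%:~R = (ev C x)%:M by apply/hyperplane_ev.
    by rewrite mul_scalar_mx scalerBl opprB addrA addrAC.
  move=> HH; have := HH _; rewrite BE; apply=> x Px; rewrite BE; split.
    by apply: (doubled_sub PQ); rewrite // subr_ge0 Pb.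
  by rewrite extendR mul1r base_sub // depth_sub // HR ab; ring.
exists (extend 0); split; last exact: extend_low.
(* If [u] lowered [C], no lattice point of G could be moved by [u] inside P, so all of them would
   lie on F. Then G is contained in F, and the two facets coincide. *)
have Gu : 0 <= ev C u.
  rewrite leNgt; apply/negP => Cu; apply: nFG.
  have GF x : G x -> F x.
    move=> [Px Cx]; split=> //; have := conj (Pb Px) Cx.
    (* The implication survives convex combinations only together with the bound on [C]: equality in
       between then forces equality at both ends. *)
    suff [_ H1] : b%:~R <= ev C x /\ (ev C x = b%:~R -> ev H x = a%:~R).
      by move=> _; exact: H1.
    apply: (full_polytope_min polP (C := [set x | _ /\ _]) _ _ Px) => [y z t|y Py] /=.
      move=> [yb yF] [zb zF] t0 t1; rewrite !ev_convex.
      have [<-|t_gt0] := eqVneq 0 t.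
        by rewrite !mul0r !add0r subr0 !mul1r.
      have [->|t_lt1] := eqVneq t 1.
        by rewrite subrr !mul0r !addr0 !mul1r.
      have {}t_gt0 : 0 < t by rewrite lt_neqAle t_gt0.
      have {}t_lt1 : t < 1 by rewrite lt_neqAle t_lt1.
      split; first by nra.
      move=> Cyz.
      have yE : ev C y = b%:~R by nra.
      have zE : ev C z = b%:~R by nra.
      by rewrite yF // zF //; ring.
    split; first exact: Pb.
    rewrite ev_toR => /intr_inj Cy; apply/eqP; rewrite eq_le Pa // andbT.
    rewrite ev_toR ler_int leNgt; apply/negP => ya.
    have := Pb (Pu Py ya); rewrite ev_toR evD ler_int Cy; lia.
  have hullGF : affine_hull G = [set x | ev H x = a%:~R].
    by apply: (facet_hull_ev facG Hu0) => x /GF[].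
  rewrite (facet_face facG) hullGF; exact: erefl.
have [_ _ _ QE] := PQ.
split=> // [z /QE[Pz z0 zC]|z|].
- by rewrite extendR mul0r subr0 Pa.
- rewrite extendZ mul0r subr0 => /(doubled_lattice PQ)[Pz z0 zC] za.
  apply/(doubled_lattice PQ); rewrite baseD base_row0 depthD depth_row0 addr0.
  by split=> //; [exact: Pu | rewrite evD; lia].
(* A point of F off G is what brings the direction [dir] into the hull of the facet above F. *)
have [x [[Px Hx] xb]] : exists x, F x /\ b%:~R < ev C x.
  apply: contrapT => nex; apply: nFG.
  have FG x : F x -> ev C x = b%:~R.
    move=> Fx; apply/eqP; rewrite eq_le (Pb Fx.1) andbT leNgt.
    by apply/negP => Cx; apply: nex; exists x.
  have facF : facet P F by have [] := column_form_base_facet colu.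
  have [_ _ [y Cy] _] := PQ.
  have hullFG : affine_hull F = [set x | ev C x = b%:~R].
    by apply: (facet_hull_ev facF (v := y)); rewrite ?Cy.
  rewrite (facet_face facF) hullFG; exact: erefl.
apply: hull_extend => z; rewrite extendR mul0r subr0 => za.
rewrite (base_depthE dR2 z).
have g0 : 0 < ev C x - b%:~R by rewrite subr_gt0.
have := @affine_hull_combine _ _ [set z | Q z /\ ev (extend 0) z = a%:~R]
   (row_mx (base (toR dir) z) 0) (row_mx x 0)
   (row_mx x 0 - (ev C x - b%:~R) *: toR dir)
   (- (depth (toR dir) z / (ev C x - b%:~R))).
rewrite subKr scalerA mulNr divfK ?lt0r_neq0 // scaleNr; apply=> //.
- by apply: hull0; rewrite hullF.
- apply: affine_hull_sub; split; first exact/(doubled_row0 PQ).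
  by rewrite extendR mul0r subr0 base_row0.
- apply: affine_hull_sub; split; first by apply: (doubled_sub PQ) => //; rewrite ltW.
  by rewrite extendR mul0r subr0 base_sub.
Qed.

End Step.

(** Otherwise a point off G could be translated by [w] forever without meeting G, against
    boundedness. *)
Lemma doubled_base_lt0 w : base_facet P w G -> ev C w < 0.
Proof.
move=> [w0 _ Pw]; rewrite ltNge; apply/negP => Cw.
have [x [Px bx]] := doubled_off PQ polP.
have Pk : forall k : nat, lattice_points P (x + k%:Z *: w) /\ b < ev C (x + k%:Z *: w).
  elim=> [|k [IH1 IH2]]; first by rewrite scale0r addr0.
  rewrite -[k.+1]addn1 PoszD scalerDl scale1r addrA; split.
    apply: Pw => // -[_ ]; rewrite ev_toR => /intr_inj E.
    by rewrite E ltxx in IH2.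
  by rewrite evD ltr_wpDr.
have [B PB] := full_polytope_bounded polP.
have /matrix0Pn[i [j wj]] := w0; rewrite !ord1 {i} in wj.
have [k kB] : exists k : nat, B + `|toR x 0 j| < k%:R.
  exists (Num.Def.archi_bound `|B + `|toR x 0 j| |).
  by apply: le_lt_trans (ler_norm _) _; apply: archi_boundP.
have kE : toR (x + k%:Z *: w) 0 j = toR x 0 j + (Posz k)%:~R * toR w 0 j.
  by rewrite !mxE intrD intrM.
have := PB _ j (Pk k).1; rewrite kE.
apply/negP; rewrite -ltNge.
have : k%:R <= `|(Posz k)%:~R * toR w 0 j| :> K.
  rewrite normrM ger0_norm ?ler0n // ler_peMr ?ler0n // mxE -intr_norm ler1z.
  by rewrite -gtz0_ge1 normr_gt0.
have := ler_normB (toR x 0 j + (Posz k)%:~R * toR w 0 j) (toR x 0 j).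
rewrite addrAC subrr add0r; lra.
Qed.

End DoubledColumns.

(** * From the metric definition of a doubling to integral coordinates *)

Section Doubling.
Context {K : realType}.
Local Notation toR := (@toR K _).

Lemma integral_mx p q (A : 'M[K]_(p, q)) :
  (forall y : 'rV[int]_p, exists w, toR y *m A = toR w) ->
  exists W : 'M[int]_(p, q), A = map_mx intr W.
Proof.
move=> intA.
have [W WE] := choice (fun i : 'I_p => intA (delta_mx 0 i)).
exists (\matrix_i W i); apply/row_matrixP => i.
rewrite -map_row rowK -[map_mx _ _]WE rowE; congr (_ *m _).
by apply/rowP => j; rewrite !mxE; case: (_ && _).
Qed.

(* In the coordinates (F-part, normal part) rho is w |-> (w - (w.nu)nu, w.nu), *)
(* so (w, 0) - rho(w) is always a multiple of (nu, -1).                        *)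
Lemma doubling_embedding m (P F : set 'rV[K]_m) (x0 : 'rV[K]_m) (nu : 'rV[K]_m)
    (M : 'M[K]_(m, m + 1)) :
  facet P F -> nu *m nu^T = 1%:M -> (forall x, F x -> (x - x0) *m nu^T = 0) ->
  (forall x, F x -> (x - x0) *m M = row_mx (x - x0) 0) ->
  nu *m M = row_mx 0 1%:M ->
  affine_hull F = [set x : 'rV[K]_m | (x - x0) *m nu^T = 0] /\
  forall w : 'rV[K]_m, row_mx w 0 - w *m M = (w *m nu^T) *m row_mx nu (- 1%:M).
Proof.
move=> facF nu1 Fnu FM nuM.
have nu0 : nu^T != 0.
  apply/eqP => nu0; move: nu1; rewrite nu0 mulmx0 => /matrixP/(_ 0 0).
  by rewrite !mxE eqxx => /eqP; rewrite eq_sym oner_eq0.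
have hullF : affine_hull F = [set x : 'rV[K]_m | (x - x0) *m nu^T = 0].
  rewrite (@facet_hull _ _ P F nu^T (x0 *m nu^T) facF nu0).
    apply/seteqP; split=> x /=; rewrite mulmxBl; first by move=> ->; rewrite subrr.
    by move/eqP; rewrite subr_eq0 => /eqP.
  by move=> x /Fnu/eqP; rewrite mulmxBl subr_eq0 => /eqP.
have hullM (w : 'rV[K]_m) : w *m nu^T = 0 -> w *m M = row_mx w 0.
  move=> wnu.
  have : affine_hull F (w + x0) by rewrite hullF /= addrK.
  move=> /(@affine_hull_min _ _ _ _ (M - row_mx 1%:M 0) (x0 *m (M - row_mx 1%:M 0))).
  have E (y : 'rV[K]_m) : y *m (M - row_mx 1%:M 0) = y *m M - row_mx y 0.
    by rewrite mulmxBr mul_mx_row mulmx1 mulmx0.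
  move=> H; apply/eqP; rewrite -subr_eq0 -E -[w](addrK x0) mulmxBl subr_eq0.
  apply/eqP/H => x /FM xM.
  by apply/eqP; rewrite -subr_eq0 -mulmxBl E xM subrr.
split=> // w.
have wE : w *m M = row_mx (w - (w *m nu^T) *m nu) (w *m nu^T).
  rewrite -{1}[w](subrK ((w *m nu^T) *m nu)) mulmxDl hullM.
    by rewrite -[X in _ + X]mulmxA nuM mul_mx_row mulmx0 mulmx1 add_row_mx addr0 add0r.
  by rewrite mulmxBl -!mulmxA nu1 mulmx1 subrr.
rewrite wE opp_row_mx add_row_mx mul_mx_row mulmxN mulmx1 add0r.
by rewrite opprB addrC subrK.
Qed.

Lemma doubling_form m (P G : set 'rV[K]_m) (Q : set 'rV[K]_(m + 1)) :
  convex P -> facet P G -> doubling P G Q ->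
  exists C b dir, doubled_form P Q C b dir /\
    G = [set x | P x /\ ev C x = b%:~R].
Proof.
move=> cP facG [x0 [nu [M [psi [Gx0 [nu1 Gnu Pnu] [_ GM nuM] [psiU psi0 psiL] QE]]]]].
have [hullG Mdir] := doubling_embedding facG nu1 Gnu GM nuM.
pose l : 'I_(m + 1) := rshift m 0.
have [W WE] : exists W : 'M[int]_(m, m + 1), M *m psi = map_mx intr W.
  apply: integral_mx => y; rewrite mulmxA; apply/psiL; exists 0, y.
  by rewrite /toR map_mx0 row_mx0 add0r.
(* The renamed lattice is all of Z^(m+1), so it contains the last basis vector, to whose last
   coordinate only the rho-part contributes. Hence the last column of [W] is primitive. *)
have [y y1] : exists y : 'rV[int]_m, (y *m W) 0 l = 1.
  have [x [y xyE]] : exists (x y : 'rV[int]_m), toR (row_mx 0 1%:M) *m invmx psi =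
       row_mx (toR x) 0 + toR y *m M.
    by apply/psiL; exists (row_mx 0 1%:M); rewrite mulmxKV.
  exists y; apply: (@intr_inj K).
  have := congr1 (fun z => (z *m psi) 0 l) xyE.
  rewrite mulmxKV // mulmxDl psi0 -mulmxA WE -map_mxM toR_row_mx.
  rewrite [RHS]mxE !row_mxEr map_mx1 [X in _ = X + _]mxE add0r [RHS]mxE => <-.
  by rewrite mxE eqxx.
(* [D] is the displacement from the mirror copy back to P at unit distance from the facet; [q]
   converts distance into the last coordinate of [W], that is, into lattice height up to sign. *)
pose D := row_mx nu (- 1%:M) *m psi; pose q := - D 0 l.
have Dpsi (w : 'rV[K]_m) : row_mx w 0 - w *m (M *m psi) = (w *m nu^T) 0 0 *: D.
  rewrite mulmxA -{1}psi0 -mulmxBl Mdir.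
  by rewrite {1}[w *m nu^T]mx11_scalar mul_scalar_mx -scalemxAl.
have Wq (w : 'rV[K]_m) : (w *m (M *m psi)) 0 l = q * (w *m nu^T) 0 0.
  have := congr1 (fun z : 'rV_(m + 1) => z 0 l) (Dpsi w).
  rewrite [LHS]mxE row_mxEr mxE add0r [LHS]mxE [RHS]mxE => E.
  by rewrite -[LHS]opprK E /q; ring.
have q0 : q != 0.
  have := Wq (toR y); rewrite WE -map_mxM mxE y1 => E.
  by apply/eqP => q0; move: E; rewrite q0 mul0r => /eqP; rewrite oner_eq0.
pose sg : int := if 0 < q then 1 else -1.
have sg2 : sg * sg = 1 by rewrite /sg; case: ifP.
have sgR2 : sg%:~R * sg%:~R = 1 :> K by rewrite -rmorphM sg2.
have sgq : 0 < sg%:~R * q.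
  rewrite /sg; have [q_gt0|q_le0] := ltrP 0 q; first by rewrite mulr1z mul1r.
  by rewrite mulrN1z mulN1r oppr_gt0 lt_neqAle q0.
(* With the sign [sg] the last column of [W] is a positive multiple of the inner normal. As [C] is 1
   at [sg *: y], the vector [dir] below is the displacement at lattice height 1. *)
pose C i : int := if insub i is Some j then sg * W j l else 0.
have CE (x : 'rV[K]_m) : ev C x = sg%:~R * q * (x *m nu^T) 0 0.
  rewrite -mulrA -Wq WE /ev !mxE mulr_sumr; apply: eq_bigr => i _.
  by rewrite !mxE /C valK rmorphM /=; ring.
pose b := ev C x0.
have bE x : ev C x - b%:~R = sg%:~R * q * ((x - toR x0) *m nu^T) 0 0.
  by rewrite /b -ev_toR -evB CE.
pose dir : 'rV[int]_(m + 1) := row_mx (sg *: y) 0 - (sg *: y) *m W.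
have dirE : toR dir = (sg%:~R * q)^-1 *: D.
  rewrite /dir toRD toRN toR_row0 /Defs.toR map_mxM -WE Dpsi; congr (_ *: _).
  apply: (mulfI (lt0r_neq0 sgq)); rewrite mulfV ?lt0r_neq0 //.
  rewrite -mulrA -Wq WE -map_mxM mxE -scalemxAl mxE y1 mulr1.
  exact: sgR2.
have dlast : dir 0 l = - sg.
  apply: (@intr_inj K); have := congr1 (fun z : 'rV_(m + 1) => z 0 l) dirE.
  rewrite mxE => ->; rewrite mxE; have -> : D 0 l = - q by rewrite opprK.
  apply: (mulfI (lt0r_neq0 sgq)); rewrite mulrA divff ?lt0r_neq0 // mul1r.
  by rewrite rmorphN /= mulrN mulrAC sgR2 mul1r.
have dirP x : P x -> row_mx (toR x0) 0 + ((x - toR x0) *m M) *m psi =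
    row_mx x 0 - (ev C x - b%:~R) *: toR dir.
  move=> _; rewrite dirE scalerA bE mulrAC mulfV ?lt0r_neq0 // mul1r -Dpsi.
  rewrite mulmxA opprB addrA addrAC; congr (_ + _).
  rewrite -[LHS]addr0; apply/rowP=> i; rewrite !mxE.
  by case: splitP => j _; rewrite ?mxE; ring.
have Pb x : P x -> b%:~R <= ev C x.
  by move=> Px; rewrite -subr_ge0 bE mulr_ge0 ?Pnu // ltW.
have GE : G = [set x | P x /\ ev C x = b%:~R].
  have cE x : (ev C x = b%:~R) <-> affine_hull G x.
    rewrite hullG /=; split=> [/eqP|xnu].
      rewrite -subr_eq0 bE mulf_eq0 (negbTE (lt0r_neq0 sgq)) => /eqP xnu.
      by apply/rowP => i; rewrite !ord1 xnu mxE.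
    by apply/eqP; rewrite -subr_eq0 bE xnu mxE mulr0.
  by rewrite {1}(facet_face facG); apply/seteqP; split=> x [Px] /cE.
exists C, b, dir; split=> //.
have dir2 : dir 0 l * dir 0 l = 1 by rewrite dlast mulrNN.
have dirR2 : toR dir 0 l * toR dir 0 l = 1 by rewrite [toR dir 0 l]mxE -rmorphM dir2.
split=> //.
  exists (sg *: y); apply: (@intr_inj K).
  rewrite -ev_toR CE -mulrA -Wq WE -map_mxM mxE -scalemxAl mxE y1 mulr1.
  exact: sgR2.
move=> z; rewrite QE; split=> [[z' z'H <-]|[Pz z0 zC]].
  have : (fun z' => exists x k, [/\ P x, 0 <= k, k <= ev C x - b%:~R
      & row_mx (toR x0) 0 + z' *m psi = row_mx x 0 - k *: toR dir]) z'.
    move: z' z'H; apply: convex_hull_min.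
      move=> z1 z2 t [x1 [k1 [Px1 k10 k1C z1E]]] [x2 [k2 [Px2 k20 k2C z2E]]] t0 t1.
      exists (t *: x1 + (1 - t) *: x2), (t * k1 + (1 - t) * k2); split.
      - exact: cP.
      - by rewrite addr_ge0 ?mulr_ge0 // subr_ge0.
      - rewrite ev_convex.
        have -> : t * ev C x1 + (1 - t) * ev C x2 - b%:~R =
          t * (ev C x1 - b%:~R) + (1 - t) * (ev C x2 - b%:~R) by ring.
        by rewrite lerD // ler_wpM2l // subr_ge0.
      have -> : row_mx (toR x0) 0 + (t *: z1 + (1 - t) *: z2) *m psi =
          t *: (row_mx (toR x0) 0 + z1 *m psi)
          + (1 - t) *: (row_mx (toR x0) 0 + z2 *m psi).
        by rewrite mulmxDl -!scalemxAl; apply/rowP=> i; rewrite !mxE; ring.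
      rewrite z1E z2E; apply/rowP=> i; rewrite !mxE.
      by case: splitP => j _; rewrite !mxE; ring.
    move=> z' [[x Px <-]|[x Px <-]].
      exists x, 0; split=> //; first by rewrite subr_ge0 Pb.
      by rewrite psi0 add_row_mx addr0 addrC subrK scale0r subr0.
    exists x, (ev C x - b%:~R); split=> //; first by rewrite subr_ge0 Pb.
    exact: dirP.
  by move=> [x [k [Px k0 kC ->]]]; rewrite base_sub ?depth_sub.
rewrite (base_depthE dirR2 z).
set x := base _ z in Pz zC *; set k := depth _ z in z0 zC *.
pose h := ev C x - b%:~R.
pose t := k / h.
have [t0 t1 tk] : [/\ 0 <= t, t <= 1 & t * h = k].
  have [h0|h0] := ltrP 0 h.
    by rewrite /t divr_ge0 ?(ltW h0) // ler_pdivrMr // mul1r divfK ?lt0r_neq0.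
  have k0 : k = 0 by apply/eqP; rewrite eq_le z0 (le_trans zC h0).
  by rewrite /t k0 !mul0r lexx ler01.
exists (t *: ((x - toR x0) *m M) + (1 - t) *: row_mx (x - toR x0) 0).
  by apply: convex_hull_convex => //; apply: convex_hull_sub; [right | left]; exists x.
rewrite mulmxDl -!scalemxAl psi0 -tk.
have := dirP x Pz; rewrite -/h => /(canRL (addKr _)) ->.
by apply/rowP=> i; rewrite !mxE; case: splitP => j _; rewrite ?mxE; ring.
Qed.

End Doubling.

(** * Monoid algebras *)

Section MonoidAlgebraTheory.
Variables (R : comPzRingType) (G : nmodType).
Local Notation A := (monoid_algebra R G).
Local Notation mon := (@mon R G).
Implicit Types (f g : A) (X : G -> A).

Lemma coeff_inj f g : (forall k, f@_k = g@_k) -> f = g.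
Proof. by move/malgP. Qed.

Lemma monD k l : mon (k + l) = mon k * mon l.
Proof. by rewrite /mon [RHS]ma_mulUU mulr1. Qed.

Lemma mon_mulrn k i : mon (k *+ i) = mon k ^+ i.
Proof. by elim: i => [|i IH]; rewrite ?expr0 ?mulr0n // mulrS exprS monD IH. Qed.

Lemma mcoeff_mon k l : (mon k)@_l = (k == l)%:R.
Proof. exact: mcoeffU. Qed.

Lemma mcoeff_scale (c : R) f k : (c *: f)@_k = c * f@_k.
Proof. exact: ma_scaleE. Qed.

Lemma scale_monE c k : c *: mon k = << c *g k >>.
Proof.
by apply: coeff_inj => l; rewrite mcoeff_scale mcoeff_mon mcoeffU mulr_natr.
Qed.

Lemma sum_monE f : f = \sum_(k <- msupp f) f@_k *: mon k.
Proof. by rewrite {1}[f]monalgE; apply: eq_bigr => k _; rewrite scale_monE. Qed.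

Lemma ma_scaleE0 c f : c *: f = (c *: mon 0) * f.
Proof.
rewrite scale_monE [f]sum_monE [RHS]mulr_sumr scaler_sumr.
apply: eq_bigr => k _; rewrite scalerA !scale_monE.
by rewrite [RHS]ma_mulUU add0r.
Qed.

Lemma ma_scaleAl c f g : c *: (f * g) = (c *: f) * g.
Proof. by rewrite ma_scaleE0 [c *: f]ma_scaleE0 mulrA. Qed.

Lemma ma_scaleAr c f g : c *: (f * g) = f * (c *: g).
Proof. by rewrite mulrC ma_scaleAl mulrC. Qed.

Definition linear_ext X f : A := \sum_(k <- msupp f) f@_k *: X k.

Lemma linear_ext_wide X f (d : {fset G}) :
  fsubset (msupp f) d -> linear_ext X f = \sum_(k <- d) f@_k *: X k.
Proof.
move=> fd; rewrite /linear_ext (big_fset_incl _ fd) // => k _ /mcoeff_outdom ->.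
by rewrite scale0r.
Qed.

Lemma linear_ext_is_linear X : linear (linear_ext X).
Proof.
move=> c f g; pose d := fsetU (msupp f) (fsetU (msupp g) (msupp (c *: f + g))).
have fd : fsubset (msupp f) d by exact: fsubsetUl.
have gd : fsubset (msupp g) d by rewrite /d fsetUCA fsubsetUl.
have fgd : fsubset (msupp (c *: f + g)) d by rewrite /d fsetUA fsubsetUr.
rewrite (linear_ext_wide X fd) (linear_ext_wide X gd) (linear_ext_wide X fgd) scaler_sumr.
rewrite -big_split /=; apply: eq_bigr => k _.
by rewrite mcoeffD mcoeff_scale scalerDl scalerA.
Qed.

HB.instance Definition _ X :=
  GRing.isLinear.Build R A A *:%R (linear_ext X) (linear_ext_is_linear X).

Lemma linear_ext_mon X k : linear_ext X (mon k) = X k.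
Proof.
by rewrite (linear_ext_wide X msuppU_le) big_seq_fset1 mcoeff_mon eqxx scale1r.
Qed.

(** Multiplicativity is asked on the supports only: [elementary_mon] has it in nonnegative degrees,
    where absolute values add up. *)
Lemma linear_ext_mul X f g :
  (forall k l, k \in msupp f -> l \in msupp g -> X (k + l) = X k * X l) ->
  linear_ext X (f * g) = linear_ext X f * linear_ext X g.
Proof.
move=> XM; rewrite [f in LHS]sum_monE [g in LHS]sum_monE.
rewrite mulr_suml linear_sum {2}/linear_ext mulr_suml big_seq [RHS]big_seq.
apply: eq_bigr => k kf; rewrite mulr_sumr linear_sum /linear_ext mulr_sumr.
rewrite big_seq [RHS]big_seq; apply: eq_bigr => l lg.
rewrite -/(linear_ext _ _) -ma_scaleAl -ma_scaleAr -monD !linearZ /= linear_ext_mon XM //.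
by rewrite -[RHS]ma_scaleAl -ma_scaleAr.
Qed.

Section Grading.
Variable deg : {additive G -> int}.

Definition homogeneous t f : Prop := {in msupp f, forall k, deg k = t}.

Lemma homogeneous_mon k : homogeneous (deg k) (mon k).
Proof.
move=> l; rewrite -mcoeff_neq0 mcoeff_mon.
by case: (k =P l) => [->|]; rewrite ?eqxx.
Qed.

Lemma homogeneous_add t f g :
  homogeneous t f -> homogeneous t g -> homogeneous t (f + g).
Proof.
move=> ft gt k; rewrite -mcoeff_neq0 mcoeffD => fgk.
have [fk|fk] := eqVneq f@_k 0; last by apply: ft; rewrite -mcoeff_neq0.
by apply: gt; rewrite -mcoeff_neq0; rewrite fk add0r in fgk.
Qed.

Lemma homogeneous_scale t c f : homogeneous t f -> homogeneous t (c *: f).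
Proof.
move=> ft k; rewrite -mcoeff_neq0 mcoeff_scale => ck; apply: ft.
by rewrite -mcoeff_neq0; apply: contra_neq ck => ->; rewrite mulr0.
Qed.

Lemma homogeneous_mul t s f g :
  homogeneous t f -> homogeneous s g -> homogeneous (t + s) (f * g).
Proof.
move=> ft gs k /msupp_ma_mul[k1 [k2 [/ft k1t /gs k2s ->]]].
by rewrite raddfD /= k1t k2s.
Qed.

Lemma homogeneous_one : homogeneous 0 1.
Proof. by rewrite -[0](raddf0 deg); exact: homogeneous_mon. Qed.

Lemma homogeneous_exp t f i : homogeneous t f -> homogeneous (t *+ i) (f ^+ i).
Proof.
move=> ft; elim: i => [|i IH]; first exact: homogeneous_one.
by rewrite exprS mulrS; exact: homogeneous_mul.
Qed.

Definition part t := linear_ext (fun k => if deg k == t then mon k else 0).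

HB.instance Definition _ t :=
  GRing.isLinear.Build R A A *:%R (part t) (linear_ext_is_linear _).

Lemma part_homogeneous t f : homogeneous t f -> part t f = f.
Proof.
move=> ft; rewrite [RHS]sum_monE /part /linear_ext big_seq [RHS]big_seq.
by apply: eq_bigr => k /ft ->; rewrite eqxx.
Qed.

Lemma part_homogeneous_neq t s f : homogeneous s f -> s != t -> part t f = 0.
Proof.
move=> fs st; rewrite /part /linear_ext big_seq big1 // => k /fs ->.
by rewrite (negbTE st) scaler0.
Qed.

Lemma homogeneous_part t f : homogeneous t (part t f).
Proof.
rewrite /part /linear_ext; elim/big_rec: _ => [k|k g _ IH]; first by rewrite msupp0.
apply: homogeneous_add => //; apply: homogeneous_scale.
by case: eqP => [<-|_ l]; [exact: homogeneous_mon | rewrite msupp0].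
Qed.

(* The binomial expansion of (1 + v)^b f has one term in each degree.         *)
Lemma part0_pow_mul (v : G) (b : nat) f : deg v = -1 -> homogeneous b f ->
  part 0 ((1 + mon v) ^+ b * f) = mon v ^+ b * f.
Proof.
move=> degv fb.
have homk i : homogeneous (b%:Z - i%:Z) (mon v ^+ i * f).
  rewrite addrC; apply: homogeneous_mul => //.
  have := homogeneous_exp (i := i) (homogeneous_mon (k := v)).
  by rewrite degv mulNrn natz.
rewrite exprDn mulr_suml linear_sum big_ord_recr /= big1 ?add0r => [|i _].
  rewrite subnn expr0 mul1r binn mulr1n part_homogeneous //.
  by have := homk b; rewrite subrr.
rewrite expr1n mul1r mulrnAl linearMn /= (part_homogeneous_neq (homk i)) ?mul0rn //.
by rewrite subr_eq0 eqz_nat neq_ltn ltn_ord orbT.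
Qed.

End Grading.

(* e_v^lam on monomials; it is only meaningful where deg >= 0.                *)
Definition elementary_mon (deg : G -> int) (v : G) (lam : R) (k : G) : A :=
  (1 + lam *: mon v) ^+ `|deg k|%N * mon k.

Section Elementary.
Variables (deg : {additive G -> int}) (v : G).
Hypothesis degv : deg v = -1.

Lemma elementary_homogeneous lam (b : nat) f : homogeneous deg b f ->
  linear_ext (elementary_mon deg v lam) f = (1 + lam *: mon v) ^+ b * f.
Proof.
move=> fb; rewrite [f in RHS]sum_monE mulr_sumr /linear_ext big_seq [RHS]big_seq.
apply: eq_bigr => k /fb degk.
by rewrite /elementary_mon degk -ma_scaleAr.
Qed.

(** The i-th term of (1 + lam v)^b k has degree b - i, so the second map multiplies it by (1 - lam
    v)^(b - i). The sum is the binomial expansion of ((1 - lam v) + lam v)^b = 1, times k. *)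
Lemma elementary_cancel lam f : {in msupp f, forall k, 0 <= deg k} ->
  linear_ext (elementary_mon deg v (- lam)) (linear_ext (elementary_mon deg v lam) f) = f.
Proof.
move=> f0; rewrite [X in linear_ext _ X]/linear_ext linear_sum [RHS]sum_monE.
rewrite big_seq [RHS]big_seq; apply: eq_bigr => k /f0 degk.
rewrite linearZ /=; congr (_ *: _).
move: degk; rewrite /elementary_mon; case E : (deg k) => [b|//] _.
rewrite absz_nat exprDn mulr_suml linear_sum /=.
transitivity ((((1 + - lam *: mon v) + lam *: mon v) ^+ b) * mon k); last first.
  by rewrite scaleNr subrK expr1n mul1r.
rewrite exprDn mulr_suml; apply: eq_bigr => i _.
rewrite expr1n mul1r !mulrnAl linearMn /=; congr (_ *+ _).
have ib : (i <= b)%N by rewrite -ltnS.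
rewrite (@elementary_homogeneous _ (b - i)%N).
  by rewrite -!mulrA.
rewrite -subzn // addrC; apply: homogeneous_mul; last first.
  by rewrite -E; exact: homogeneous_mon.
rewrite -natz -mulNrn -degv; apply/homogeneous_exp/homogeneous_scale.
exact: homogeneous_mon.
Qed.

Lemma elementary_mul lam f g :
  {in msupp f, forall k, 0 <= deg k} -> {in msupp g, forall k, 0 <= deg k} ->
  linear_ext (elementary_mon deg v lam) (f * g) =
  linear_ext (elementary_mon deg v lam) f * linear_ext (elementary_mon deg v lam) g.
Proof.
move=> f0 g0; apply: linear_ext_mul => k l /f0 degk /g0 degl.
rewrite /elementary_mon raddfD /= monD mulrACA -exprD; congr (_ ^+ _ * _).
by case: (deg k) (deg l) degk degl => // a [].
Qed.

End Elementary.

End MonoidAlgebraTheory.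

(** * The stable algebra *)

Section StableAlgebraTheory.
Context {K : realType} {R : comPzRingType} {n : nat} {P : set 'rV[K]_n}.
Variable S : doubling_spectrum P.
Local Notation G := ({poly int} * int)%type.
Local Notation A := (monoid_algebra R G).
Local Notation SA := (stable_algebra R S).

Lemma stable_mem_sum (I : Type) (r : seq I) (p : pred I) (F : I -> A) :
  (forall i, p i -> F i \in stable_mem S) ->
  \sum_(i <- r | p i) F i \in stable_mem S.
Proof.
have [mem0 memD] := GRing.zmod_closedD (GRing.subring_closedB (stable_subring R S)).
by move=> SF; elim/big_rec: _ => // i f pi fS; apply: memD => //; exact: SF.
Qed.

Lemma stable_memD (f g : A) :
  f \in stable_mem S -> g \in stable_mem S -> f + g \in stable_mem S.
Proof.
have [_ memD] := GRing.zmod_closedD (GRing.subring_closedB (stable_subring R S)).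
exact: memD.
Qed.

Lemma stable_memM (f g : A) :
  f \in stable_mem S -> g \in stable_mem S -> f * g \in stable_mem S.
Proof. by have [_ _ memM] := stable_subring R S; exact: memM. Qed.

Lemma stable_mem1 : (1 : A) \in stable_mem S.
Proof. by have [] := stable_subring R S. Qed.

Lemma stable_memZ (c : R) (f : A) : f \in stable_mem S -> c *: f \in stable_mem S.
Proof. exact: stable_scale. Qed.

Lemma hpoint_row0 m (x : 'rV[int]_m) : hpoint (row_mx x 0 : 'rV_(m + 1)) = hpoint x.
Proof. by rewrite /hpoint rVpoly_row_mx0. Qed.

Lemma chain_lattice_row0 i x :
  lattice_points (S i) x -> lattice_points (S i.+1) (row_mx x 0).
Proof.
have [_ /(_ i)[w [_ [F [_ dbl]]]] _] := chainP S.
by rewrite /lattice_points /= toR_row0; exact: doubling_sub dbl.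
Qed.

Lemma chain_lift i j x : (i <= j)%N -> lattice_points (S i) x ->
  exists y, lattice_points (S j) y /\ rVpoly y = rVpoly x.
Proof.
move=> + Sx; elim: j => [|j IH]; first by rewrite leqn0 => /eqP i0; subst i; exists x.
rewrite leq_eqVlt => /predU1P[ij|/IH[y [Sy yx]]]; first by subst i; exists x.
by exists (row_mx y 0); rewrite rVpoly_row_mx0; split=> //; exact: chain_lattice_row0.
Qed.

Definition stable_semigroup (g : G) : Prop := exists i, polytope_semigroup (S i) g.

Lemma stable_suppP (f : A) :
  f \in stable_mem S -> {in msupp f, forall k, stable_semigroup k}.
Proof. by move=> /asboolP[i fi] k /fi ki; exists i. Qed.

(* Levels below N can be ignored, as L_(P_i) is contained in L_(P_N) for them. *)
Lemma stable_semigroup_ind N (T : G -> SA -> Prop) : T 0 1 ->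
  (forall i x (Sx : lattice_points (S i) x) k a, (N <= i)%N ->
     T k a -> T (hpoint x + k) (stable_point R Sx * a)) ->
  forall g, stable_semigroup g -> exists a, val a = mon R g /\ T g a.
Proof.
move=> T0 TD _ [i [s [Ss ->]]]; elim: s Ss => [|x s IH] Ss.
  by exists 1; rewrite big_nil.
have [|a [aE Ta]] := IH; first by move=> y ys; apply: Ss; rewrite inE ys orbT.
have [|y [Sy yx]] := chain_lift (leq_maxl i N) (x := x); first exact/Ss/mem_head.
exists (stable_point R Sy * a); rewrite big_cons -[hpoint x]/(rVpoly x, 1) -yx.
split; last by apply: TD => //; exact: leq_maxr.
by rewrite rmorphM monD /= aE.
Qed.

Lemma stable_semigroup_mem g : stable_semigroup g -> mon R g \in stable_mem S.
Proof.
move=> /(@stable_semigroup_ind 0 (fun _ _ => True))[] // a [<- _].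
exact: valP.
Qed.

(** * Elementary automorphisms of the limit algebra *)

Section ElementaryAutomorphism.
Variables (deg : {additive G -> int}) (v : G).
Hypothesis degv : deg v = -1.
Hypothesis deg_ge0 : forall i x, lattice_points (S i) x -> 0 <= deg (hpoint x).
Hypothesis deg_gt0 : forall i x, lattice_points (S i) x -> 0 < deg (hpoint x) ->
  exists j y, lattice_points (S j) y /\ hpoint y = hpoint x + v.

Lemma stable_deg_ge0 (f : A) :
  f \in stable_mem S -> {in msupp f, forall k, 0 <= deg k}.
Proof.
move=> fS k /(stable_suppP fS)[i [s [Ss ->]]]; rewrite raddf_sum big_seq.
by apply: sumr_ge0 => x /Ss; exact: deg_ge0.
Qed.

(** Splitting one factor off leaves the same expression with exponent one less at x and, scaled by
    [lam], at x + v, a lattice point of some level whose degree is one less. So the induction must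
    allow the level to vary. *)
Lemma elementary_point_mem (lam : R) (h : nat) i x : lattice_points (S i) x ->
  h%:Z <= deg (hpoint x) ->
  (1 + lam *: mon R v) ^+ h * mon R (hpoint x) \in stable_mem S.
Proof.
elim: h i x => [|h IH] i x Sx hx.
  by rewrite expr0 mul1r; exact: stable_point_subproof.
have [|j [y [Sy yx]]] := deg_gt0 Sx; first exact: lt_le_trans hx.
rewrite exprSr mulrDr mulr1 mulrDl; apply: stable_memD.
  by apply: (IH i) => //; apply: le_trans hx; lia.
rewrite -mulrA -ma_scaleAl -monD addrC -yx -ma_scaleAr; apply: stable_memZ.
apply: (IH j) => //; rewrite yx raddfD /= degv; lia.
Qed.

Lemma elementary_mon_mem (lam : R) g : stable_semigroup g ->
  elementary_mon deg v lam g \in stable_mem S.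
Proof.
move=> [i [s [Ss ->]]]; rewrite /elementary_mon.
elim: s Ss => [|x s IH] Ss.
  by rewrite big_nil raddf0 absz0 expr0 mul1r; exact: stable_mem1.
have Sx : lattice_points (S i) x by apply: Ss; rewrite mem_head.
have {}Ss : {in s, forall y, lattice_points (S i) y}.
  by move=> y ys; apply: Ss; rewrite inE ys orbT.
have degx := deg_ge0 Sx.
have degs : 0 <= deg (\sum_(y <- s) hpoint y).
  by rewrite raddf_sum big_seq; apply: sumr_ge0 => y /Ss; exact: deg_ge0.
rewrite big_cons raddfD /= monD.
have abszD (a b : int) : 0 <= a -> 0 <= b -> absz (a + b) = (absz a + absz b)%N.
  by lia.
rewrite abszD //.
rewrite exprD mulrACA; apply: stable_memM; last exact: IH.
by apply: (elementary_point_mem _ Sx); rewrite gez0_abs.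
Qed.

Lemma elementary_mem (lam : R) (f : A) : f \in stable_mem S ->
  linear_ext (elementary_mon deg v lam) f \in stable_mem S.
Proof.
move=> fS; rewrite /linear_ext big_seq; apply: stable_mem_sum => k /(stable_suppP fS) Sk.
exact/stable_memZ/elementary_mon_mem.
Qed.

Definition elementary_fun (lam : R) (f : SA) : SA :=
  StableAlgebra (elementary_mem lam (valP f)).

Lemma elementary_fun_automorphism (lam : R) : algebra_automorphism (elementary_fun lam).
Proof.
split.
- split=> [|f g]; apply: val_inj => /=.
    rewrite [LHS](linear_ext_mon _ 0) /elementary_mon raddf0 absz0 expr0 mul1r.
    by [].
  by apply: elementary_mul; apply: stable_deg_ge0; exact: valP.
- by move=> c f g; apply: val_inj; rewrite /= !linearP.
exists (elementary_fun (- lam)) => f; apply: val_inj => /=.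
  by apply: elementary_cancel => //; apply: stable_deg_ge0; exact: valP.
rewrite -{1}[lam]opprK.
by apply: elementary_cancel => //; apply: stable_deg_ge0; exact: valP.
Qed.

Definition elementary (lam : R) : stable_aut R S :=
  StableAut (elementary_fun_automorphism lam).

End ElementaryAutomorphism.

Section Parts.
Variable deg : {additive G -> int}.

Lemma part_mem t (f : A) : f \in stable_mem S -> part deg t f \in stable_mem S.
Proof.
move=> fS; rewrite /part /linear_ext big_seq; apply: stable_mem_sum => k.
move=> /(stable_suppP fS) kS.
apply: stable_memZ; case: ifP => _; first exact: stable_semigroup_mem.
by have := stable_memZ 0 stable_mem1; rewrite scale0r.
Qed.

Definition stable_part t (f : SA) : SA := StableAlgebra (part_mem t (valP f)).

Lemma stable_part_is_linear t : linear (stable_part t).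
Proof. by move=> c f g; apply: val_inj; rewrite /= linearP. Qed.

HB.instance Definition _ t :=
  GRing.isLinear.Build R SA SA *:%R (stable_part t) (stable_part_is_linear t).

(* Equivalent to "z preserves homogeneity", but visibly inherited by z^-1.    *)
Definition graded (z : stable_aut R S) : Prop :=
  forall t f, z (stable_part t f) = stable_part t (z f).

End Parts.

Lemma stable_sumE (f : SA) : exists a : G -> SA,
  f = \sum_(k <- msupp (val f)) (val f)@_k *: a k /\
  {in msupp (val f), forall k, val (a k) = mon R k}.
Proof.
have fS := valP f.
have mon_mem k : k \in msupp (val f) -> mon R k \in stable_mem S.
  by move=> /(stable_suppP fS); exact: stable_semigroup_mem.
pose a k : SA := insubd 0 (mon R k).
have aE k : k \in msupp (val f) -> val (a k) = mon R k.
  by move=> /mon_mem ks; rewrite /a insubdK.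
exists a; split=> //; apply: val_inj.
rewrite [LHS]sum_monE [RHS]raddf_sum; apply: eq_big_seq => k kf.
by rewrite [RHS]linearZ /= aE.
Qed.

Section Automorphisms.
Variable z : stable_aut R S.

Lemma aut_linear : linear z. Proof. by have [] := aut_funP z. Qed.
Lemma aut_monoid_morphism : GRing.monoid_morphism z.
Proof. by have [] := aut_funP z. Qed.

HB.instance Definition _ := GRing.isLinear.Build R SA SA *:%R z aut_linear.
HB.instance Definition _ := GRing.isMonoidMorphism.Build SA SA z aut_monoid_morphism.

Lemma graded_points (deg : {additive G -> int}) N :
  (forall i x (Sx : lattice_points (S i) x), (N <= i)%N ->
     homogeneous deg (deg (hpoint x)) (val (z (stable_point R Sx)))) ->
  graded deg z.
Proof.
move=> zpt t f; have [a [fE aE]] := stable_sumE f; rewrite fE.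
rewrite !linear_sum; apply: eq_big_seq => k kf.
rewrite !linearZ /=; congr (_ *: _).
have zk : homogeneous deg (deg k) (val (z (a k))).
  have Sk := stable_suppP (valP f) kf.
  pose T k a := homogeneous deg (deg k) (val (z a)).
  have [||b [bk Tb]] := @stable_semigroup_ind N T _ _ _ Sk.
  - by rewrite /T rmorph1 raddf0; exact: homogeneous_one.
  - move=> i x Sx l b Ni Tb; rewrite /T !rmorphM raddfD.
    by apply: homogeneous_mul Tb; exact: zpt.
  suff -> : a k = b by exact: Tb.
  by apply: val_inj; rewrite aE ?bk.
apply: val_inj => /=; have [<-|tk] := eqVneq (deg k) t.
  rewrite part_homogeneous //; congr (val (z _)); apply: val_inj => /=.
  by rewrite aE // part_homogeneous //; exact: homogeneous_mon.
rewrite (part_homogeneous_neq zk) //.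
have -> : stable_part deg t (a k) = 0; last by rewrite raddf0.
apply: val_inj => /=; rewrite aE // (part_homogeneous_neq (@homogeneous_mon R _ deg k)) //.
Qed.

Lemma aut_eq1 : (forall i x (Sx : lattice_points (S i) x),
  z (stable_point R Sx) = stable_point R Sx) -> z = 1%g.
Proof.
move=> zpt; apply: stable_autP => f; have [a [fE aE]] := stable_sumE f; rewrite fE.
rewrite linear_sum; apply: eq_big_seq => k kf.
rewrite linearZ /=; congr (_ *: _).
have Sk := stable_suppP (valP f) kf.
have [||b [bk zb]] := @stable_semigroup_ind 0 (fun _ a => z a = a) _ _ _ Sk.
- exact: rmorph1.
- by move=> i x Sx l b _ zb; rewrite rmorphM /= zpt zb.
by have -> : a k = b by apply: val_inj; rewrite aE ?bk.
Qed.

End Automorphisms.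

End StableAlgebraTheory.

(** * The center *)

Section LimitForm.

Definition poly_ev (C : nat -> int) (p : {poly int}) : int :=
  \sum_(i < size p) p`_i * C i.

Lemma poly_ev_wide C (p : {poly int}) m : (size p <= m)%N ->
  poly_ev C p = \sum_(i < m) p`_i * C i.
Proof.
move=> pm; rewrite /poly_ev (big_ord_widen m (fun i => p`_i * C i) pm).
rewrite big_mkcond /=; apply: eq_bigr => i _; case: ltnP => // ip.
by rewrite nth_default ?mul0r.
Qed.

Lemma poly_evB C : zmod_morphism (poly_ev C).
Proof.
move=> p q; pose m := maxn (size p) (size q).
rewrite (poly_ev_wide C (leq_maxl _ _ : (size p <= m)%N)).
rewrite (poly_ev_wide C (leq_maxr _ _ : (size q <= m)%N)).
rewrite (@poly_ev_wide C _ m); last by rewrite (leq_trans (size_polyD _ _)) ?size_polyN.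
by rewrite -sumrB; apply: eq_bigr => i _; rewrite coefB mulrBl.
Qed.

Lemma poly_ev_rVpoly C m (x : 'rV[int]_m) : poly_ev C (rVpoly x) = ev C x.
Proof.
rewrite (@poly_ev_wide C _ m) ?size_poly // /ev !mxE; apply: eq_bigr => i _.
by rewrite coef_rVpoly_ord !mxE intz.
Qed.

(** The second component of [g] could carry the constant term of a height; it is ignored because
    that constant is 0 for the forms of [limit_form]. *)
Definition degree (C : nat -> int) (g : {poly int} * int) : int := poly_ev C g.1.

Lemma degreeB C : zmod_morphism (degree C).
Proof. by move=> g h; exact: poly_evB. Qed.

HB.instance Definition _ C :=
  GRing.isZmodMorphism.Build ({poly int} * int)%type int (degree C) (degreeB C).

Context {K : realType} {n : nat} {P : set 'rV[K]_n}.
Variable S : doubling_spectrum P.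

Lemma column_form_prefix m (Q : set 'rV[K]_m) v C C' b :
  (forall i, (i < m)%N -> C i = C' i) -> column_form Q v C b ->
  column_form Q v C' b.
Proof.
move=> CC'; rewrite /column_form.
have -> : @ev K C m = @ev K C' m by apply/funext => x; exact: ev_prefix.
by have -> : @ev int C m = @ev int C' m by apply/funext => x; exact: ev_prefix.
Qed.

Lemma sdimE i : sdim n i = (n + i)%N.
Proof. by elim: i => [|i IH] /=; rewrite ?addn0 // IH addn1 addnS. Qed.

Hypothesis PL : lattice_polytope P.

Lemma chain_full i : full_polytope (S i).
Proof.
elim: i => [|i IH].
  have [-> _ _] := chainP S; have [Ps Pdim _] := PL.
  by split; last exact: affine_dim_full.
have [_ /(_ i)[w [_ [F [[_ facF _] dbl]]]] _] := chainP S.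
have [C [b [dir [dF _]]]] := doubling_form (full_polytope_convex IH) facF dbl.
exact: doubled_full dF IH.
Qed.

Lemma chain_doubled i w : doubling_along (S i) w (S i.+1) ->
  exists C b dir, doubled_form (S i) (S i.+1) C b dir /\
    base_facet (S i) w [set x | S i x /\ ev C x = b%:~R].
Proof.
move=> [F [wF dbl]]; have [_ facF _] := wF.
have [C [b [dir [dF FE]]]] :=
  doubling_form (full_polytope_convex (chain_full i)) facF dbl.
by exists C, b, dir; split=> //; rewrite -FE.
Qed.

Lemma limit_form j C b dir : doubled_form (S j) (S j.+1) C b dir ->
  exists H : nat -> int, (forall i, (i < sdim n j)%N -> H i = 0) /\
    forall k, (j < k)%N -> exists v, rVpoly v = rVpoly dir /\ column_form (S k) v H 0.
Proof.
move=> dF.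
(* With the level written in this order, passing from [k] to [k.+1] is a successor by computation,
   so no casts between dimensions arise. *)
pose T k (H : nat -> int) := exists v : 'rV[int]_(sdim n (k + j.+1)),
  rVpoly v = rVpoly dir /\ column_form (S (k + j.+1)) v H 0.
have [H0 [colH0 H00]] := doubled_start dF (chain_full j).
have T0 : T 0%N H0 by exists dir.
have next k H : T k H -> exists H', T k.+1 H' /\
    forall i, (i < sdim n (k + j.+1))%N -> H' i = H i.
  move=> [v [vdir colv]].
  have [_ /(_ (k + j.+1)%N)[w [_ dbl]] _] := chainP S.
  have [C1 [b1 [d1 [dF1 [_ facG _]]]]] := chain_doubled dbl.
  have [H' [colH' H'H]] := doubled_step dF1 (chain_full _) facG colv.
  exists H'; split=> //; exists (row_mx v 0).
  by rewrite rVpoly_row_mx0.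
pose next_sig k (h : {H | T k H}) : {H | T k.+1 H} :=
  let s := cid (next k (sval h) (svalP h)) in exist _ (sval s) (svalP s).1.
pose h : forall k, {H | T k H} :=
  nat_rect (fun k => {H | T k H}) (exist _ H0 T0) next_sig.
have hS k i : (i < sdim n (k + j.+1))%N -> sval (h k.+1) i = sval (h k) i.
  by move=> ik; have [_ HE] := svalP (cid (next k _ (svalP (h k)))); exact: HE.
have hD k l i : (i < sdim n (k + j.+1))%N -> sval (h (l + k)%N) i = sval (h k) i.
  move=> ik; elim: l => [|l IH] //; rewrite -IH; apply: hS.
  by apply: leq_trans ik _; rewrite !sdimE leq_add2l leq_add2r leq_addl.
(* The diagonal is the limit: stage i already has n + i + j + 1 coordinates, so entry i is frozen
   from there on. *)
pose H i := sval (h i) i.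
have hH k i : (i < sdim n (k + j.+1))%N -> sval (h k) i = H i.
  move=> ik; rewrite /H; have [le_ik|lt_ki] := leqP i k.
    have := @hD i (k - i)%N i; rewrite subnK //; apply.
    by rewrite sdimE !addnS ltnS addnCA leq_addr.
  by have := @hD k (i - k)%N i ik; rewrite subnK // ltnW.
exists H; split=> [i ij|k jk].
  rewrite -(hH 0%N); first exact: H00.
  by rewrite /= addn1 ltnS ltnW.
rewrite -(subnK jk); have [v [vdir colv]] := svalP (h (k - j.+1)%N).
exists v; split=> //; apply: column_form_prefix colv; exact: hH.
Qed.

End LimitForm.

Section Center.
Context {K : realType} {R : comPzRingType} {n : nat} {P : set 'rV[K]_n}.
Variable S : doubling_spectrum P.
Hypothesis PL : lattice_polytope P.
Local Notation G := ({poly int} * int)%type.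
Local Notation SA := (stable_algebra R S).
Implicit Types (z : stable_aut R S) (U : seq {poly int}).

(* For a column vector u this says that x lies on the base facet of u, in a   *)
(* form that does not refer to the facet.                                     *)
Definition on_base i (x : 'rV[int]_(sdim n i)) (u : {poly int}) : Prop :=
  exists v, rVpoly v = u /\ ~ lattice_points (S i) (x + v).

Lemma stable_elementary_aut j C b dir (lam : R) :
  doubled_form (S j) (S j.+1) C b dir -> exists H e,
  [/\ forall i, (i < sdim n j)%N -> H i = 0,
      degree H (hvect (rVpoly dir)) = -1,
      stable_elementary_group R S e
    & forall f, val (e f) =
        linear_ext (elementary_mon (degree H) (hvect (rVpoly dir)) lam) (val f)].
Proof.
move=> dF; have [H [Hj colH]] := limit_form PL dF.
pose v := hvect (rVpoly dir).
have degv : degree H v = -1.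
  have [d [dE [_ Hd _ _]]] := colH j.+1 (ltnSn j).
  by rewrite /v -dE /degree poly_ev_rVpoly.
have degE i (x : 'rV[int]_(sdim n i)) : degree H (hpoint x) = ev H x.
  by rewrite /degree poly_ev_rVpoly.
have lift_point i x : lattice_points (S i) x ->
    exists k y, [/\ (j < k)%N, lattice_points (S k) y & hpoint y = hpoint x].
  move=> Sx; have [y [Sy yx]] := chain_lift (leq_maxl i j.+1) Sx.
  exists (maxn i j.+1), y; split=> //; first exact: leq_maxr.
  by rewrite /hpoint yx.
have deg_ge0 i x : lattice_points (S i) x -> 0 <= degree H (hpoint x).
  move=> /lift_point[k [y [jk Sy <-]]]; have [d [_ [H0 _ _ _]]] := colH k jk.
  by rewrite degE -(ler_int K) -ev_toR; exact: H0.
have deg_gt0 i x : lattice_points (S i) x -> 0 < degree H (hpoint x) ->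
    exists k y, lattice_points (S k) y /\ hpoint y = hpoint x + v.
  move=> /lift_point[k [y [jk Sy <-]]]; have [d [dE [_ _ H0 _]]] := colH k jk.
  rewrite degE => y0; exists k, (y + d); split; first exact: H0.
  by rewrite /hpoint /v /hvect -dE raddfD /= -[RHS]/(_, _) addr0.
exists H, (elementary degv deg_ge0 deg_gt0 lam); split=> //.
move=> A [_]; apply; exists (rVpoly dir), lam; split.
  have [d [dE colk]] := colH j.+1 (ltnSn j).
  exists j.+1, d; split=> //; exists [set x | S j.+1 x /\ ev H x = 0%:~R].
  exact: column_form_base_facet.
exists j.+1 => k jk; have [d [dE colk]] := colH k jk.
exists d, [set x | S k x /\ ev H x = 0%:~R].
split; [exact: dE | exact: column_form_base_facet |].
move=> x Sx; rewrite (column_form_height x (chain_full S PL k) colk) subr0 -degE.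
exact: linear_ext_mon.
Qed.

(* z x = m * z x' with x' the image of x in the mirror copy of P_j, by the    *)
(* degree 0 part of z (e_dir x') = e_dir (z x').                              *)
Lemma central_mirror z U j w x (Sx : lattice_points (S j) x) :
  doubling_along (S j) w (S j.+1) ->
  (forall e, stable_elementary_group R S e -> commute z e) ->
  (forall deg : {additive G -> int}, (forall u, u \in U -> deg (hvect u) = 0) ->
     graded deg z) ->
  (forall u, u \in U -> exists v : 'rV[int]_(sdim n j), rVpoly v = u) ->
  exists x' (Sx' : lattice_points (S j.+1) x') m,
  [/\ hpoint x = m + hpoint x',
      val (z (stable_point R Sx)) = mon R m * val (z (stable_point R Sx')),
      forall u, on_base x u -> on_base x' u & on_base x' (rVpoly w)].
Proof.
move=> dbl zcomm zgr Uj; have [C [b [dir [dF wF]]]] := chain_doubled PL dbl.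
have [_ facG _] := wF; have polS := chain_full S PL j.
have d2 : dir 0 (rshift (sdim n j) 0) * dir 0 (rshift (sdim n j) 0) = 1 by have [] := dF.
have [g gE] : exists g : nat, ev C x - b = g.
  have : 0 <= ev C x - b.
    by rewrite subr_ge0 -(ler_int K) -ev_toR; have [H _ _ _] := dF; exact: H.
  by case: (ev C x - b) => // g _; exists g.
pose x' : 'rV[int]_(sdim n j.+1) := row_mx x 0 - g%:Z *: dir.
have Sx' : lattice_points (S j.+1) x'.
  by apply/(doubled_lattice dF); rewrite base_sub // depth_sub // gE.
(* The degree 0 part carries the coefficient lam^g, which lam = 1 makes trivial. *)
have [H [e [Hj degv eE eval]]] := stable_elementary_aut 1 dF.
pose v := hvect (rVpoly dir).
have xE : hpoint x = v *+ g + hpoint x'.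
  rewrite -hpoint_row0 -[row_mx x 0](subrK (g%:Z *: dir)) -/x'.
  rewrite /hpoint raddfD /= -[g%:Z]natz scaler_nat raddfMn addrC.
  have -> : v *+ g = (rVpoly dir *+ g, 0).
    elim: {gE x' Sx'} g => [|g IH]; first by rewrite !mulr0n.
    by rewrite !mulrS IH /v -[LHS]/(_, _) addr0.
  by rewrite -[RHS]/(_, _) add0r.
exists x', Sx', (v *+ g); split=> //.
- have degx' : degree H (hpoint x') = g.
    have : degree H (hpoint x) = 0.
      rewrite /degree poly_ev_rVpoly /ev !mxE big1 // => i _.
      by rewrite !mxE Hj ?mulr0.
    rewrite xE raddfD raddfMn /= degv mulNrn natz addrC => /eqP.
    by rewrite subr_eq0 => /eqP.
  have zg : graded (degree H) z.
    apply: zgr => u /Uj[d <-]; rewrite /= /degree poly_ev_rVpoly /ev !mxE big1 // => i _.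
    by rewrite !mxE Hj ?mulr0.
  have part_e (f : SA) : homogeneous (degree H) g (val f) ->
      val (stable_part (degree H) 0 (e f)) = mon R (v *+ g) * val f.
    move=> fg; rewrite /= eval (elementary_homogeneous _ _ fg) scale1r.
    by rewrite (part0_pow_mul degv fg) mon_mulrn.
  have x'g : homogeneous (degree H) g (val (stable_point R Sx')).
    by rewrite -degx'; exact: homogeneous_mon.
  have zx'g : homogeneous (degree H) g (val (z (stable_point R Sx'))).
    have -> : stable_point R Sx' = stable_part (degree H) g (stable_point R Sx').
      by apply: val_inj; rewrite /= part_homogeneous.
    rewrite zg; exact: homogeneous_part.
  have -> : stable_point R Sx = stable_part (degree H) 0 (e (stable_point R Sx')).
    by apply: val_inj; rewrite part_e //= xE monD.
  rewrite zg -(part_e _ zx'g); congr (val (stable_part _ _ _)).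
  have := congr1 (fun h : stable_aut R S => h (stable_point R Sx')) (zcomm e eE).
  by [].
(* The base of x' + d is x + d, which is outside the old polytope. *)
- move=> u [d [<- Sxd]]; exists (row_mx d 0); split; first exact: rVpoly_row_mx0.
  move/(doubled_lattice dF) => [+ _ _].
  by rewrite baseD base_sub // base_row0.
(* Adding [w] keeps the depth at [g], while the height of x + w, the greatest depth allowed there,
   is below [g]. *)
exists (row_mx w 0); split; first exact: rVpoly_row_mx0.
move/(doubled_lattice dF) => [_ _].
rewrite baseD base_sub // base_row0 depthD depth_sub // depth_row0 evD.
have := doubled_base_lt0 dF polS wF; lia.
Qed.

Lemma height_face m (Q F : set 'rV[K]_m) x :
  lattice_points Q x -> F (toR x) -> height Q F x = 0.
Proof.
move=> Qx Fx; rewrite /height; case: xgetP => // h -> [f [b [[_ _ _ fF] ->]]].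
by rewrite fF // subrr.
Qed.

(** This replaces a factorisation of z: [U] collects the vectors of the factors, and [N] is a level
    from which all their defining formulas hold. *)
Definition tame z : Prop := exists U N,
  [/\ forall u, u \in U -> forall i, (N <= i)%N ->
        exists v, Col (S i) v /\ rVpoly v = u,
      forall deg : {additive G -> int}, (forall u, u \in U -> deg (hvect u) = 0) ->
        graded deg z
    & forall i x (Sx : lattice_points (S i) x), (N <= i)%N ->
        (forall u, u \in U -> on_base x u) ->
        z (stable_point R Sx) = stable_point R Sx].

Lemma elementary_tame u lam z : elementary_aut u lam z -> tame z.
Proof.
move=> [N zE]; exists [:: u], N; split.
- move=> _ /[!inE] /eqP -> i /zE[v [F [vu vF _]]].
  by exists v; split=> //; exists F.
- move=> deg degu; have {}degu := degu u (mem_head _ _).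
  apply: (graded_points (N := N)) => i x Sx /zE[v [F [_ _ ->]]].
  rewrite -[deg _]add0r; apply: homogeneous_mul; last exact: homogeneous_mon.
  rewrite -(mul0rn int `|height (S i) F x|%N); apply: homogeneous_exp.
  apply: homogeneous_add; first exact: homogeneous_one.
  by rewrite -degu; apply: homogeneous_scale; exact: homogeneous_mon.
move=> i x Sx Ni xu; have [v [F [vu [_ _ vF] zx]]] := zE i Ni.
have [d [du Sxd]] := xu u (mem_head _ _).
have dv : d = v by apply: (can_inj rVpolyK); rewrite du vu.
(* Off the base facet x + v would stay in the polytope; so x has height 0 and the power in the
   formula is 1. *)
have Fx : F (toR x) by apply: contrapT => nFx; apply: Sxd; rewrite dv; exact: vF.
by apply: val_inj; rewrite zx (height_face Sx Fx) absz0 expr0 mul1r.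
Qed.

Lemma tame_subgroup : subgroup tame.
Proof.
split.
  by exists [::], 0%N; split.
move=> y z [U [N [UN ygr yfix]]] [V [M [VM zgr zfix]]].
have zK f : z ((z^-1)%g f) = f.
  by have := congr1 (fun h : stable_aut R S => h f) (aut_mulVr z).
have Kz f : (z^-1)%g (z f) = f.
  by have := congr1 (fun h : stable_aut R S => h f) (aut_mulVl z).
exists (U ++ V), (maxn N M); split.
- move=> u; rewrite mem_cat => /orP[uU|uV] i; rewrite geq_max => /andP[Ni Mi].
    exact: UN.
  exact: VM.
- move=> deg degUV t f.
  have degU u : u \in U -> deg (hvect u) = 0.
    by move=> uU; apply: degUV; rewrite mem_cat uU.
  have degV u : u \in V -> deg (hvect u) = 0.
    by move=> uV; apply: degUV; rewrite mem_cat uV orbT.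
  rewrite -[LHS]/(y ((z^-1)%g (stable_part deg t f))).
  rewrite -[in LHS](zK f) -zgr // Kz.
  exact: ygr.
move=> i x Sx; rewrite geq_max => /andP[Ni Mi] xUV.
rewrite -[LHS]/(y ((z^-1)%g (stable_point R Sx))).
have -> : (z^-1)%g (stable_point R Sx) = stable_point R Sx.
  rewrite -[in LHS](zfix _ _ Sx) ?Kz // => u uV.
  by apply: xUV; rewrite mem_cat uV orbT.
by apply: yfix => // u uU; apply: xUV; rewrite mem_cat uU.
Qed.

Lemma stable_elementary_tame z : stable_elementary_group R S z -> tame z.
Proof.
apply; split; first exact: tame_subgroup.
by move=> e [u [lam [_]]]; exact: elementary_tame.
Qed.

Section Central.
Variable z : stable_aut R S.
Hypothesis zcomm : forall e, stable_elementary_group R S e -> commute z e.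
Variables (U : seq {poly int}) (N : nat).
Hypothesis U_col : forall u, u \in U -> forall i, (N <= i)%N ->
  exists v, Col (S i) v /\ rVpoly v = u.
Hypothesis zgr : forall deg : {additive G -> int},
  (forall u, u \in U -> deg (hvect u) = 0) -> graded deg z.
Hypothesis zfix : forall i x (Sx : lattice_points (S i) x), (N <= i)%N ->
  (forall u, u \in U -> on_base x u) -> z (stable_point R Sx) = stable_point R Sx.

(** [m] accumulates the powers of the successive mirror directions; the relation is transitive, so
    mirrorings can be chained. *)
Let mirrored i (x : 'rV[int]_(sdim n i)) j (x' : 'rV[int]_(sdim n j)) :=
  exists m, [/\ hpoint x = m + hpoint x',
    forall Sx Sx', val (z (@stable_point _ R _ _ S i x Sx)) =
                   mon R m * val (z (@stable_point _ R _ _ S j x' Sx'))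
  & forall u, on_base x u -> on_base x' u].

Let mirrored_trans i x j x1 k x2 : lattice_points (S j) x1 ->
  @mirrored i x j x1 -> @mirrored j x1 k x2 -> mirrored x x2.
Proof.
move=> Sx1 [m [xE zx xU]] [m' [x1E zx1 x1U]]; exists (m + m'); split.
- by rewrite xE x1E addrA.
- by move=> Sx Sx2; rewrite (zx Sx Sx1) (zx1 Sx1 Sx2) monD -[RHS]mulrA.
- by move=> u /xU/x1U.
Qed.

Let mirror_along j w x : (N <= j)%N -> lattice_points (S j) x ->
  doubling_along (S j) w (S j.+1) -> exists x' : 'rV[int]_(sdim n j.+1),
  [/\ lattice_points (S j.+1) x', mirrored x x' & on_base x' (rVpoly w)].
Proof.
move=> Nj Sx dbl.
have [|x' [Sx' [m [xE zx xU xw]]]] := central_mirror Sx dbl zcomm zgr.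
  by move=> u /U_col/(_ j Nj)[v [_ vu]]; exists v.
exists x'; split; [exact: Sx' | exists m; split | exact: xw].
- exact: xE.
- move=> Sx1 Sx1'.
  by rewrite (Prop_irrelevance Sx1 Sx) (Prop_irrelevance Sx1' Sx').
- exact: xU.
Qed.

(** The spectrum may double along other vectors before the awaited one; mirroring there as well
    preserves the relation. *)
Let mirror_le i k x : (N <= i)%N -> (i <= k)%N -> lattice_points (S i) x ->
  exists x' : 'rV[int]_(sdim n k), lattice_points (S k) x' /\ mirrored x x'.
Proof.
move=> Ni + Sx; elim: k => [|k IH].
  rewrite leqn0 => /eqP i0; subst i; exists x; split=> //.
  exists 0; split=> // [|Sx1 Sx2]; first by rewrite add0r.
  by rewrite (Prop_irrelevance Sx1 Sx2) mul1r.
rewrite leq_eqVlt => /predU1P[ik|ik].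
  subst i; exists x; split=> //.
  exists 0; split=> // [|Sx1 Sx2]; first by rewrite add0r.
  by rewrite (Prop_irrelevance Sx1 Sx2) mul1r.
have [x1 [Sx1 xx1]] := IH ik.
have [_ /(_ k)[w [_ dbl]] _] := chainP S.
have [x2 [Sx2 x12 _]] := mirror_along (leq_trans Ni ik) Sx1 dbl.
by exists x2; split=> //; exact: mirrored_trans x12.
Qed.

(** One vector at a time: condition (ii) of a spectrum supplies a later level that doubles along
    [u], and base facets already reached are never left again. *)
Let mirror_all (V : seq {poly int}) i x :
  {subset V <= U} -> (N <= i)%N -> lattice_points (S i) x ->
  exists k (x' : 'rV[int]_(sdim n k)),
  [/\ (N <= k)%N, lattice_points (S k) x', mirrored x x'
    & forall u, u \in V -> on_base x' u].
Proof.
move=> VU Ni Sx; elim: V VU => [|u V IH] VU.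
  have [x' [Sx' xx']] := mirror_le Ni (leqnn i) Sx.
  by exists i, x'; split.
have [|k [x1 [Nk Sx1 xx1 x1V]]] := IH.
  by move=> v vV; apply: VU; rewrite inE vV orbT.
have [v [vcol vu]] := U_col (VU u (mem_head _ _)) Nk.
have [_ _ /(_ _ _ vcol)[j [w [kj wv dbl]]]] := chainP S.
have [x2 [Sx2 x12]] := mirror_le Nk kj Sx1.
have [x3 [Sx3 x23 x3w]] := mirror_along (leq_trans Nk kj) Sx2 dbl.
have x13 := mirrored_trans Sx2 x12 x23.
exists j.+1, x3; split=> //.
- exact: leq_trans Nk (leqW kj).
- exact: mirrored_trans x13.
- move=> u'; rewrite inE => /predU1P[->|/x1V]; first by rewrite -vu -wv.
  by have [m [_ _]] := x13; apply.
Qed.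

Lemma central_eq1 : z = 1%g.
Proof.
apply: aut_eq1 => i x Sx.
have [y [Sy yx]] := chain_lift (leq_maxl i N) Sx.
have -> : stable_point R Sx = stable_point R Sy.
  by apply: val_inj; rewrite /= /hpoint yx.
have [k [x' [Nk Sx' [m [yE zy _]] x'U]]] := mirror_all (fun u uU => uU) (leq_maxr i N) Sy.
apply: val_inj; rewrite (zy Sy Sx') (zfix Sx' Nk x'U) /= -monD.
by rewrite yE.
Qed.

End Central.

End Center.

Theorem theorem7p7 (K : realType) (R : comPzRingType) (n : nat)
    (P : set 'rV[K]_n) (PL : lattice_polytope P) (colP : Col P !=set0)
    (S : doubling_spectrum P) :
  center_of (stable_elementary_group R S) = [set 1%g].
Proof.
apply/seteqP; split=> [z [/stable_elementary_tame[U [N [UN zgr zfix]]] zcomm]|_ ->].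
  exact: (central_eq1 PL zcomm UN zgr zfix).
split; first by move=> A [[A1 _] _].
by move=> h _; rewrite /commute mul1g mulg1.
Qed.
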